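(* Let $f:\mathbb{R}_+\to[0,\infty)$ be a real-analytic nonnegative function, let $\epsilon>0$ be a constant, and set $\nu(n)=\epsilon f(n)$. Consider the Cauchy problem $$\frac{\partial V}{\partial t}+V\frac{\partial V}{\partial x}=-E-\nu(n)V,\qquad \frac{\partial E}{\partial t}+V\frac{\partial E}{\partial x}=V,\qquad n=1-\frac{\partial E}{\partial x},$$ for $t\ge 0$, $x\in\mathbb{R}$, with affine initial data $$V|_{t=0}=a_0x+A_0,\qquad E|_{t=0}=b_0x+B_0,\qquad a_0,A_0,b_0,B_0\in\mathbb{R},\quad b_0<1,$$ whose solution has the form $V=a(t)x+A(t)$, $E=b(t)x+B(t)$. (i) If $$\int_{\eta_0}^{+\infty}\frac{f(\eta)}{\eta^2}\,d\eta=\infty \qquad (\eta_0>0),$$ then for any choice of such affine initial data the derivatives $V_x=a(t)$ and $E_x=b(t)$ of the solution are bounded in time. (ii) Otherwise (i.e. if this integral converges), there exist such affine initial data for which the derivatives of the solution blow up in a finite time.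
   Context: The unknowns are the velocity $V(t,x)$ and the electric field $E(t,x)$, real-valued functions of $t\ge 0$ and $x\in\mathbb{R}$; $n=1-\partial E/\partial x$ is the electron density, assumed positive ($n>0$), and $\nu(n)\ge 0$ is the density-dependent damping coefficient. $\mathbb{R}_+=(0,\infty)$. Divergence of the integral does not depend on the choice of the lower limit $\eta_0>0$. The solution meant is the unique (real-analytic) solution, which exists locally in time by the Cauchy-Kovalevskaya theorem. Blow-up of the derivatives in a finite time means that there is $t_*<\infty$ such that the solution exists on $[0,t_* )$ and its derivatives ($V_x$, $E_x$) become unbounded as $t\to t_*$. *)

(* Defs.v *)
From Stdlib Require Import Reals.
From Coquelicot Require Import Coquelicot.
Open Scope R_scope.

Definition analytic_at (f : R -> R) (x0 : R) : Prop :=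
  exists (c : nat -> R) (r : R),
    0 < r /\
    forall x : R, Rabs (x - x0) < r -> is_pseries c (x - x0) (f x).

Definition in_time (T : Rbar) (t : R) : Prop := 0 <= t /\ Rbar_lt t T.

(* Real-analyticity on the strip [0, T) x R, relative to the strip: at t0 = 0
   the expansion is only required on the side t >= 0.  The bound on the
   coefficients makes the double series converge absolutely on the open
   bidisc of radius r, so that the order of summation is immaterial. *)
Definition analytic_on_strip (T : Rbar) (V : R -> R -> R) : Prop :=
  forall t0 x0 : R, in_time T t0 ->
  exists (c : nat -> nat -> R) (r M : R),
    0 < r /\
    (forall i j : nat, Rabs (c i j) * r ^ (i + j) <= M) /\
    forall t x : R, in_time T t -> Rabs (t - t0) < r -> Rabs (x - x0) < r ->
      V t x = Series (fun i => Series (fun j =>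
                c i j * (t - t0) ^ i * (x - x0) ^ j)).

(* Derivative relative to the half-line [0, +oo): the usual derivative for
   t > 0, the right derivative at t = 0. *)
Definition is_time_derive (g : R -> R) (t l : R) : Prop :=
  filterdiff g (within (fun s => 0 <= s) (locally t)) (fun h => scal h l).

Definition solves_system (nu : R -> R) (T : Rbar) (V E : R -> R -> R) : Prop :=
  forall t x : R, in_time T t ->
  exists Vt Vx Et Ex : R,
    is_time_derive (fun s => V s x) t Vt /\
    is_derive (fun y => V t y) x Vx /\
    is_time_derive (fun s => E s x) t Et /\
    is_derive (fun y => E t y) x Ex /\
    let n := 1 - Ex in
    0 < n /\
    Vt + V t x * Vx = - E t x - nu n * V t x /\
    Et + V t x * Ex = V t x.

Record cauchy_solution (nu V0 E0 : R -> R) (T : Rbar) (V E : R -> R -> R)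
    : Prop := {
  sol_lifespan : Rbar_lt 0 T;
  sol_V_analytic : analytic_on_strip T V;
  sol_E_analytic : analytic_on_strip T E;
  sol_system : solves_system nu T V E;
  sol_V_init : forall x : R, V 0 x = V0 x;
  sol_E_init : forall x : R, E 0 x = E0 x
}.

Definition affine_in_space (T : Rbar) (V : R -> R -> R) : Prop :=
  exists a A : R -> R,
    forall t x : R, in_time T t -> V t x = a t * x + A t.

Definition x_derivative_bounded (T : Rbar) (V : R -> R -> R) : Prop :=
  exists M : R,
    forall t x : R, in_time T t -> Rabs (Derive (fun y => V t y) x) <= M.

Definition x_derivative_blows_up (tstar : R) (V : R -> R -> R) : Prop :=
  forall M delta : R, 0 < delta ->
  exists t x : R,
    in_time tstar t /\ tstar - delta < t /\
    M < Rabs (Derive (fun y => V t y) x).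

Definition improper_integral_diverges (g : R -> R) (eta0 : R) : Prop :=
  is_lim (fun X => RInt g eta0 X) p_infty p_infty.

(* Main.v *)
Require Import Defs.
From Stdlib Require Import Reals.
From Coquelicot Require Import Coquelicot.
From Stdlib Require Import Lra Lia ClassicalEpsilon Classical.
Open Scope R_scope.

(** For [V = a x + A] and [E = (1 - n) x + B] the system reduces to ordinary
    differential equations
<<
      n' = - a n,               a' = - a^2 + n - 1 - eps f(n) a,
      B' = A n,                 A' = - a A - B - eps f(n) A.
>>
    The first two do not involve [A] and [B].  In terms of [s = 1/n] and
    [p = a/n] they become a damped oscillator with equilibrium [s = 1],
<<
      s' = p,                   p' = 1 - s - eps f(1/s) p,
>>
    whose energy [p^2 + (s - 1)^2] does not increase.  Hence [p] and [s] are
    always bounded, and gradients can blow up only if [s] reaches 0.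

    Let [H(n)] be the integral of [f(eta) / eta^2] from [eta0] to [n].  Since
    [(H(n))' = - f(n) p], the damping cancels in [q = p - eps H(n)], and
    [q' = 1 - s].  While [s <= 1], [q] increases, and as [p] is bounded this
    bounds [H(n)] from above ([density_bounded]).  If the integral diverges, [n]
    is therefore bounded, hence so are [a = p n] and [1 - n], on any time
    interval.  If it converges, [H] is bounded, so that, by [q' <= 1], a
    sufficiently negative initial [p] stays below [- 2] up to time 1
    ([inverse_density_falls]); then [s], starting from 1, would have to vanish
    before time 3/4, which is where the solution must end.

    Existence rests on three facts.  A differential equation with analytic
    right-hand side has an analytic local solution: the coefficients of the
    formal solution are dominated by [C rho^k / (k + 1)^2], a weight stable
    under products and composition ([local_analytic_solution]).  Solutions are
    locally unique by Gronwall's inequality ([local_uniqueness]); so every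
    solution is analytic, and solutions with the same initial state patch
    together.  Finally, a maximal solution of finite lifespan leaves every
    compact set of states with [n > 0] ([maximal_solution]); the linear
    equations for [A] and [B] cannot cause this as long as [n] and [a] are
    bounded, which leaves the gradients ([maximal_affine_solution]). *)

(** * Coefficient majorants *)

(** The factor [1 / (k + 1)^2] makes this weight submultiplicative for the
    Cauchy product up to the constant 8, which a plain geometric weight is
    not. *)
Definition weight (rho : R) (k : nat) : R := rho ^ k / (INR k + 1) ^ 2.

Definition majorized (C rho : R) (a : nat -> R) : Prop :=
  forall k : nat, Rabs (a k) <= C * weight rho k.

Lemma weight_pos (rho : R) (k : nat) : 0 < rho -> 0 < weight rho k.
Proof.
  intros Hrho. unfold weight. pose proof (pos_INR k).
  apply Rdiv_lt_0_compat; [apply pow_lt | apply pow_lt]; lra.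
Qed.

Lemma weight_le_pow (rho : R) (k : nat) : 0 < rho -> weight rho k <= rho ^ k.
Proof.
  intros Hrho. unfold weight. pose proof (pos_INR k).
  assert (1 <= (INR k + 1) ^ 2) by nra.
  assert (0 < rho ^ k) by (apply pow_lt; lra).
  apply Rmult_le_reg_r with ((INR k + 1) ^ 2); [lra|].
  unfold Rdiv. rewrite Rmult_assoc, Rinv_l by lra. nra.
Qed.

Lemma majorized_const_ge0 (C rho : R) (a : nat -> R) :
  0 < rho -> majorized C rho a -> 0 <= C.
Proof.
  intros Hrho Ha. specialize (Ha 0%nat).
  pose proof (weight_pos rho 0 Hrho). pose proof (Rabs_pos (a 0%nat)). nra.
Qed.

Lemma majorized_le (C D rho : R) (a : nat -> R) :
  0 < rho -> C <= D -> majorized C rho a -> majorized D rho a.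
Proof.
  intros Hrho HCD Ha k. specialize (Ha k).
  pose proof (weight_pos rho k Hrho). nra.
Qed.

Lemma majorized_plus (C D rho : R) (a b : nat -> R) :
  majorized C rho a -> majorized D rho b ->
  majorized (C + D) rho (PS_plus a b).
Proof.
  intros Ha Hb k. specialize (Ha k). specialize (Hb k).
  unfold PS_plus. change (plus (a k) (b k)) with (a k + b k).
  pose proof (Rabs_triang (a k) (b k)). lra.
Qed.

Lemma sum_inv_squares_le (n : nat) :
  sum_f_R0 (fun i => / (INR i + 1) ^ 2) n <= 2 - / (INR n + 1).
Proof.
  induction n as [|n IH].
  - simpl. rewrite Rplus_0_l, !Rmult_1_r, Rinv_1. lra.
  - rewrite tech5, S_INR. pose proof (pos_INR n).
    enough (/ (INR n + 1 + 1) ^ 2 <= / (INR n + 1) - / (INR n + 1 + 1)) by lra.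
    replace (/ (INR n + 1) - / (INR n + 1 + 1))
      with (/ ((INR n + 1) * (INR n + 1 + 1))) by (field; lra).
    apply Rinv_le_contravar; [apply Rmult_lt_0_compat; lra | simpl; nra].
Qed.

Lemma sum_f_R0_rev (u : nat -> R) (n : nat) :
  sum_f_R0 (fun i => u (n - i)%nat) n = sum_f_R0 u n.
Proof.
  induction n as [|n IH].
  - reflexivity.
  - rewrite decomp_sum by lia. rewrite (tech5 u), <- IH, Rplus_comm. f_equal.
Qed.

(** Partial fractions: [1/((i+1)(j+1)) = (1/(i+1) + 1/(j+1)) / (i+j+2)], so that
    the square of the left-hand side is at most
    [2 (1/(i+1)^2 + 1/(j+1)^2) / (i+j+2)^2], and [sum 1/(i+1)^2 <= 2]. *)
Lemma weight_convolution (rho : R) (n : nat) :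
  0 < rho ->
  sum_f_R0 (fun i => weight rho i * weight rho (n - i)) n
    <= 8 * weight rho n.
Proof.
  intros Hrho. pose proof (pos_INR n) as Hn.
  set (s := fun i : nat => / (INR i + 1) ^ 2).
  apply Rle_trans with
    (sum_f_R0 (fun i => 2 * weight rho n * (s i + s (n - i)%nat)) n).
  - apply sum_Rle. intros i Hi. unfold weight, s.
    replace (rho ^ n) with (rho ^ i * rho ^ (n - i))
      by (rewrite <- pow_add; f_equal; lia).
    assert (Hij : INR n = INR i + INR (n - i))
      by (rewrite <- plus_INR; f_equal; lia).
    pose proof (pos_INR i) as Hi0. pose proof (pos_INR (n - i)) as Hj0.
    set (x := INR i + 1) in *. set (y := INR (n - i) + 1) in *.
    assert (Hx : 0 < x) by (unfold x; lra).
    assert (Hy : 0 < y) by (unfold y; lra).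
    replace (INR n + 1) with (x + y - 1) by (unfold x, y; lra).
    assert (Hp : 0 < rho ^ i * rho ^ (n - i))
      by (apply Rmult_lt_0_compat; apply pow_lt; lra).
    set (p := rho ^ i) in *. set (q := rho ^ (n - i)) in *.
    replace (p / x ^ 2 * (q / y ^ 2)) with (p * q * / (x ^ 2 * y ^ 2))
      by (field; lra).
    replace (2 * (p * q / (x + y - 1) ^ 2) * (/ x ^ 2 + / y ^ 2))
      with (p * q * (2 * (x ^ 2 + y ^ 2) * / (x + y - 1) ^ 2
                      * / (x ^ 2 * y ^ 2)))
      by (field; unfold x, y in *; lra).
    apply Rmult_le_compat_l; [lra|].
    rewrite <- (Rmult_1_l (/ (x ^ 2 * y ^ 2))) at 1.
    apply Rmult_le_compat_r.
    { apply Rlt_le, Rinv_0_lt_compat.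
      apply Rmult_lt_0_compat; apply pow_lt; lra. }
    assert (0 < (x + y - 1) ^ 2) by (apply pow_lt; unfold x, y; lra).
    apply Rmult_le_reg_r with ((x + y - 1) ^ 2); [lra|].
    rewrite Rmult_assoc, Rinv_l by lra.
    assert (1 <= x) by (unfold x; lra). assert (1 <= y) by (unfold y; lra).
    pose proof (pow2_ge_0 (x - y)). nra.
  - rewrite (sum_eq _ (fun i => (s i + s (n - i)%nat) * (2 * weight rho n)))
      by (intros; ring).
    rewrite <- scal_sum, plus_sum, sum_f_R0_rev.
    pose proof (sum_inv_squares_le n) as Hs. fold s in Hs.
    assert (0 < / (INR n + 1)) by (apply Rinv_0_lt_compat; lra).
    pose proof (weight_pos rho n Hrho). nra.
Qed.

Lemma majorized_mult (C D rho : R) (a b : nat -> R) :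
  0 < rho -> majorized C rho a -> majorized D rho b ->
  majorized (8 * C * D) rho (PS_mult a b).
Proof.
  intros Hrho Ha Hb n. unfold PS_mult.
  pose proof (majorized_const_ge0 _ _ _ Hrho Ha) as HC.
  pose proof (majorized_const_ge0 _ _ _ Hrho Hb) as HD.
  eapply Rle_trans; [apply Rsum_abs|].
  apply Rle_trans with
    (sum_f_R0 (fun i => weight rho i * weight rho (n - i) * (C * D)) n).
  - apply sum_Rle. intros i _. rewrite Rabs_mult.
    replace (weight rho i * weight rho (n - i) * (C * D))
      with (C * weight rho i * (D * weight rho (n - i))) by ring.
    apply Rmult_le_compat; auto using Rabs_pos.
  - rewrite <- scal_sum.
    replace (8 * C * D * weight rho n) with (C * D * (8 * weight rho n)) by ring.
    apply Rmult_le_compat_l; [apply Rmult_le_pos; lra|].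
    exact (weight_convolution rho n Hrho).
Qed.

Lemma majorized_CV_radius (C rho : R) (a : nat -> R) :
  0 < rho -> majorized C rho a -> Rbar_le (/ rho) (CV_radius a).
Proof.
  intros Hrho Ha. apply CV_radius_bounded. exists C. intros k.
  rewrite Rabs_mult, (Rabs_pos_eq ((/ rho) ^ k))
    by (apply pow_le, Rlt_le, Rinv_0_lt_compat; lra).
  pose proof (majorized_const_ge0 _ _ _ Hrho Ha) as HC.
  rewrite pow_inv. specialize (Ha k).
  pose proof (weight_le_pow rho k Hrho) as Hw.
  assert (Hp : 0 < rho ^ k) by (apply pow_lt; lra).
  apply Rmult_le_reg_r with (rho ^ k); [lra|].
  rewrite Rmult_assoc, Rinv_l, Rmult_1_r; [|lra].
  eapply Rle_trans; [exact Ha|]. apply Rmult_le_compat_l; lra.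
Qed.

Lemma majorized_inside (C rho t : R) (a : nat -> R) :
  0 < rho -> majorized C rho a -> rho * Rabs t <= / 2 ->
  Rbar_lt (Rabs t) (CV_radius a).
Proof.
  intros Hrho Ha Ht.
  apply Rbar_lt_le_trans with (/ rho);
    [simpl | exact (majorized_CV_radius C rho a Hrho Ha)].
  apply Rmult_lt_reg_l with rho; [lra|]. rewrite Rinv_r by lra. lra.
Qed.

Lemma majorized_PSeries_le (C rho t : R) (a : nat -> R) :
  0 < rho -> majorized C rho a -> rho * Rabs t <= / 2 ->
  Rabs (PSeries a t) <= 2 * C.
Proof.
  intros Hrho Ha Ht.
  pose proof (majorized_const_ge0 _ _ _ Hrho Ha) as HC.
  assert (Hgeom : is_series (fun k => C * (/ 2) ^ k) (C * / (1 - / 2))).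
  { apply (@is_series_scal_l R_AbsRing R_NormedModule C). apply is_series_geom.
    rewrite Rabs_pos_eq; lra. }
  assert (Hle : forall k, 0 <= Rabs (a k * t ^ k) <= C * (/ 2) ^ k).
  { intros k. split; [apply Rabs_pos|]. rewrite Rabs_mult, <- RPow_abs.
    apply Rle_trans with (C * rho ^ k * Rabs t ^ k).
    - apply Rmult_le_compat_r; [apply pow_le, Rabs_pos|].
      pose proof (weight_le_pow rho k Hrho). specialize (Ha k). nra.
    - rewrite Rmult_assoc, <- Rpow_mult_distr.
      apply Rmult_le_compat_l; [lra|].
      apply pow_incr. split; [|exact Ht].
      apply Rmult_le_pos; [lra | apply Rabs_pos]. }
  unfold PSeries.
  eapply Rle_trans.
  { apply Series_Rabs.
    apply (@ex_series_le R_AbsRing R_CompleteNormedModule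
             _ (fun k => C * (/ 2) ^ k)).
    - intros k. change (Rabs (Rabs (a k * t ^ k)) <= C * (/ 2) ^ k).
      rewrite Rabs_Rabsolu. apply Hle.
    - eexists. exact Hgeom. }
  replace (2 * C) with (C * / (1 - / 2)) by field.
  rewrite <- (is_series_unique _ _ Hgeom).
  apply Series_le; [exact Hle|]. eexists. exact Hgeom.
Qed.

(** * Composition with a power series *)

Definition PS_one (k : nat) : R := match k with O => 1 | S _ => 0 end.

Fixpoint PS_pow (u : nat -> R) (m : nat) : nat -> R :=
  match m with O => PS_one | S m => PS_mult u (PS_pow u m) end.

Definition PS_tail (u : nat -> R) (k : nat) : R :=
  match k with O => 0 | S _ => u k end.

(** The formal composite of [sum_m c m X^m] with [u - u 0].  The inner series
    has no constant term, so powers beyond the [k]-th do not contribute to the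
    [k]-th coefficient. *)
Definition PS_comp (c u : nat -> R) (k : nat) : R :=
  sum_f_R0 (fun m => c m * PS_pow (PS_tail u) m k) k.

Lemma PS_one_majorized (rho : R) : 0 < rho -> majorized 1 rho PS_one.
Proof.
  intros Hrho [|k].
  - unfold weight. simpl. rewrite Rabs_R1. lra.
  - simpl PS_one. rewrite Rabs_R0. pose proof (weight_pos rho (S k) Hrho). lra.
Qed.

Lemma PS_pow_majorized (d rho : R) (u : nat -> R) (m : nat) :
  0 < rho -> majorized d rho u -> majorized ((8 * d) ^ m) rho (PS_pow u m).
Proof.
  intros Hrho Hu. induction m as [|m IH].
  - exact (PS_one_majorized rho Hrho).
  - pose proof (majorized_mult _ _ _ _ _ Hrho Hu IH) as H.
    simpl. exact H.
Qed.

Lemma PS_pow_low (u : nat -> R) (m k : nat) :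
  u 0%nat = 0 -> (k < m)%nat -> PS_pow u m k = 0.
Proof.
  intros Hu. revert k. induction m as [|m IH]; intros k Hk; [lia|].
  simpl. unfold PS_mult. apply sum_eq_R0. intros [|i] Hi.
  - rewrite Hu. ring.
  - rewrite IH by lia. ring.
Qed.

Lemma is_pseries_PS_one (t : R) : is_pseries PS_one t 1.
Proof.
  assert (H : is_lim_seq (sum_n (fun k => PS_one k * t ^ k)) 1).
  { apply is_lim_seq_ext with (fun _ => 1); [|apply is_lim_seq_const].
    intros n. induction n as [|n IH].
    - rewrite sum_O. simpl. ring.
    - rewrite sum_Sn, <- IH. simpl. unfold plus. simpl. ring. }
  apply is_pseries_R. exact H.
Qed.

Lemma PSeries_PS_one (t : R) : PSeries PS_one t = 1.
Proof. apply is_pseries_unique, is_pseries_PS_one. Qed.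

Lemma PSeries_PS_pow (d rho t : R) (u : nat -> R) (m : nat) :
  0 < rho -> majorized d rho u -> rho * Rabs t <= / 2 ->
  PSeries (PS_pow u m) t = PSeries u t ^ m.
Proof.
  intros Hrho Hu Ht. induction m as [|m IH].
  - exact (PSeries_PS_one t).
  - simpl. rewrite PSeries_mult, IH; [reflexivity| |].
    + exact (majorized_inside _ _ _ _ Hrho Hu Ht).
    + exact (majorized_inside _ _ _ _ Hrho
               (PS_pow_majorized _ _ _ m Hrho Hu) Ht).
Qed.

Lemma sum_f_R0_geometric_tail (B : R) (v : nat -> R) (N p : nat) :
  (forall m, Rabs (v m) <= B * (/ 2) ^ m) ->
  Rabs (sum_f_R0 v (N + p) - sum_f_R0 v N)
    <= B * ((/ 2) ^ N - (/ 2) ^ (N + p)).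
Proof.
  intros Hv. induction p as [|p IH].
  - rewrite Nat.add_0_r, !Rminus_diag, Rabs_R0. lra.
  - rewrite Nat.add_succ_r, tech5.
    pose proof (Hv (S (N + p))) as H. simpl in H |- *.
    replace (sum_f_R0 v (N + p) + v (S (N + p)) - sum_f_R0 v N)
      with (sum_f_R0 v (N + p) - sum_f_R0 v N + v (S (N + p))) by ring.
    eapply Rle_trans; [apply Rabs_triang|]. lra.
Qed.

Lemma sum_f_R0_geometric (B : R) (v : nat -> R) (N : nat) :
  0 <= B -> (forall m, Rabs (v m) <= B * (/ 2) ^ m) ->
  Rabs (sum_f_R0 v N) <= 2 * B.
Proof.
  intros HB Hv. pose proof (sum_f_R0_geometric_tail B v 0 N Hv) as H.
  specialize (Hv 0%nat). simpl in H, Hv.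
  assert (0 < (/ 2) ^ N) by (apply pow_lt; lra).
  replace (sum_f_R0 v N) with (sum_f_R0 v N - v 0%nat + v 0%nat) by ring.
  eapply Rle_trans; [apply Rabs_triang|]. nra.
Qed.

Section Composition.

Variables (c u : nat -> R) (M r d rho : R).
Hypothesis (Hrho : 0 < rho) (Hd : 0 <= d).
Hypothesis (Hc : forall m, Rabs (c m) * r ^ m <= M).
Hypothesis (Hu : majorized d rho (PS_tail u)).
Hypothesis (Hdr : 16 * d <= r).

Lemma composition_const_ge0 : 0 <= M.
Proof.
  specialize (Hc 0%nat). pose proof (Rabs_pos (c 0%nat)). simpl in Hc. lra.
Qed.

Lemma composition_term_le (m k : nat) :
  Rabs (c m * PS_pow (PS_tail u) m k) <= M * weight rho k * (/ 2) ^ m.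
Proof.
  rewrite Rabs_mult.
  pose proof (PS_pow_majorized d rho (PS_tail u) m Hrho Hu k) as Hp.
  pose proof (weight_pos rho k Hrho) as Hw.
  apply Rle_trans with (Rabs (c m) * ((8 * d) ^ m * weight rho k)).
  { apply Rmult_le_compat_l; [apply Rabs_pos | exact Hp]. }
  apply Rle_trans with (Rabs (c m) * ((r * / 2) ^ m * weight rho k)).
  { apply Rmult_le_compat_l; [apply Rabs_pos|].
    apply Rmult_le_compat_r; [lra|]. apply pow_incr. lra. }
  rewrite Rpow_mult_distr.
  replace (Rabs (c m) * (r ^ m * (/ 2) ^ m * weight rho k))
    with (Rabs (c m) * r ^ m * (weight rho k * (/ 2) ^ m)) by ring.
  rewrite (Rmult_assoc M). apply Rmult_le_compat_r; [|exact (Hc m)].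
  apply Rmult_le_pos; [lra | apply pow_le; lra].
Qed.

Lemma PS_comp_majorized : majorized (2 * M) rho (PS_comp c u).
Proof.
  intros k. unfold PS_comp. rewrite Rmult_assoc.
  apply sum_f_R0_geometric.
  - apply Rmult_le_pos; [exact composition_const_ge0|].
    apply Rlt_le, weight_pos, Hrho.
  - intros m. apply composition_term_le.
Qed.

Lemma PS_comp_truncation_majorized (N : nat) :
  majorized (M * (/ 2) ^ N) rho
    (fun k => PS_comp c u k
              - sum_f_R0 (fun m => c m * PS_pow (PS_tail u) m k) N).
Proof.
  intros k. unfold PS_comp.
  pose proof composition_const_ge0 as HM.
  pose proof (weight_pos rho k Hrho) as Hw.
  assert (H2 : forall n, 0 < (/ 2) ^ n) by (intros; apply pow_lt; lra).
  set (v := fun m => c m * PS_pow (PS_tail u) m k).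
  destruct (Nat.le_gt_cases N k) as [HNk|HNk].
  - replace k with (N + (k - N))%nat at 1 by lia.
    eapply Rle_trans.
    { apply sum_f_R0_geometric_tail with (B := M * weight rho k).
      intros m. apply composition_term_le. }
    specialize (H2 (N + (k - N))%nat).
    assert (0 <= M * weight rho k) by (apply Rmult_le_pos; lra). nra.
  - assert (Hz : forall p, sum_f_R0 v (k + p) = sum_f_R0 v k).
    { induction p as [|p IH]; [f_equal; lia|].
      rewrite Nat.add_succ_r, tech5, IH. unfold v.
      rewrite PS_pow_low by (reflexivity || lia). ring. }
    replace N with (k + (N - k))%nat at 1 by lia.
    rewrite Hz, Rminus_diag, Rabs_R0. specialize (H2 N).
    apply Rmult_le_pos; [apply Rmult_le_pos|]; lra.
Qed.

Lemma PSeries_truncation (N : nat) (t : R) :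
  rho * Rabs t <= / 2 ->
  (exists C, majorized C rho
     (fun k => sum_f_R0 (fun m => c m * PS_pow (PS_tail u) m k) N)) /\
  PSeries (fun k => sum_f_R0 (fun m => c m * PS_pow (PS_tail u) m k) N) t
  = sum_f_R0 (fun m => c m * PSeries (PS_tail u) t ^ m) N.
Proof.
  intros Ht.
  assert (Hterm : forall m,
    (exists C, majorized C rho (fun k => c m * PS_pow (PS_tail u) m k)) /\
    PSeries (fun k => c m * PS_pow (PS_tail u) m k) t
    = c m * PSeries (PS_tail u) t ^ m).
  { intros m. split.
    - exists (M * (/ 2) ^ m). intros k.
      pose proof (composition_term_le m k). lra.
    - rewrite <- (PSeries_PS_pow d rho t (PS_tail u) m Hrho Hu Ht).
      apply (PSeries_scal (c m)). }
  induction N as [|N [[C HC] IH]].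
  - exact (Hterm 0%nat).
  - destruct (Hterm (S N)) as [[D HD] E]. split.
    + exists (C + D). exact (majorized_plus _ _ _ _ _ HC HD).
    + rewrite tech5, <- IH, <- E.
      apply (PSeries_plus _ (fun k => c (S N) * PS_pow (PS_tail u) (S N) k)).
      * apply CV_radius_inside. exact (majorized_inside _ _ _ _ Hrho HC Ht).
      * apply CV_radius_inside. exact (majorized_inside _ _ _ _ Hrho HD Ht).
Qed.

(** Truncating the outer series at [N] changes every coefficient of the formal
    composite by at most [M / 2^N] times the weight; hence the sum at [t]
    changes by at most [2 M / 2^N], and both sides are limits of the same
    sequence. *)
Lemma is_pseries_PS_comp (t : R) :
  rho * Rabs t <= / 2 ->
  is_pseries c (PSeries (PS_tail u) t) (PSeries (PS_comp c u) t).
Proof.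
  intros Ht. apply is_pseries_R. unfold is_series.
  change (is_lim_seq (sum_n (fun m => c m * PSeries (PS_tail u) t ^ m))
            (PSeries (PS_comp c u) t)).
  apply is_lim_seq_ext with
    (fun N => PSeries (PS_comp c u) t
              - PSeries (fun k => PS_comp c u k
                  - sum_f_R0 (fun m => c m * PS_pow (PS_tail u) m k) N) t).
  - intros N. destruct (PSeries_truncation N t Ht) as [[C HC] E].
    rewrite sum_n_Reals, <- E.
    rewrite <- PSeries_minus.
    + apply PSeries_ext. intros k.
      unfold PS_minus, PS_plus, PS_opp, plus, opp. simpl. ring.
    + apply CV_radius_inside.
      exact (majorized_inside _ _ _ _ Hrho PS_comp_majorized Ht).
    + apply CV_radius_inside.
      exact (majorized_inside _ _ _ _ Hrho
               (PS_comp_truncation_majorized N) Ht).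
  - rewrite <- (Rminus_0_r (PSeries (PS_comp c u) t)) at 1.
    apply is_lim_seq_minus'; [apply is_lim_seq_const|].
    apply is_lim_seq_abs_0.
    apply is_lim_seq_le_le with (fun _ => 0) (fun N => 2 * M * (/ 2) ^ N).
    + intros N. split; [apply Rabs_pos|]. rewrite Rmult_assoc.
      exact (majorized_PSeries_le _ _ _ _ Hrho
               (PS_comp_truncation_majorized N) Ht).
    + apply is_lim_seq_const.
    + rewrite <- (Rmult_0_r (2 * M)).
      apply (is_lim_seq_scal_l _ (2 * M) 0), is_lim_seq_geom.
      rewrite Rabs_pos_eq; lra.
Qed.

End Composition.

(** * Analytic differential equations *)

(** The coordinates [n, a, A, B] of a solution [V = a x + A],
    [E = (1 - n) x + B]. *)
Inductive coord : Set := cn | ca | cA | cB.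

Definition state : Type := coord -> R.

(** Right-hand sides are kept as syntax: what is needed of them (power series,
    Lipschitz constants, bounds) is then obtained by induction.  [Density]
    stands for a given function of the coordinate [cn]. *)
Inductive expr : Type :=
  | Const (r : R)
  | Coord (i : coord)
  | Sum (e1 e2 : expr)
  | Prod (e1 e2 : expr)
  | Density.

Fixpoint eval (f : R -> R) (e : expr) (y : state) : R :=
  match e with
  | Const r => r
  | Coord i => y i
  | Sum e1 e2 => eval f e1 y + eval f e2 y
  | Prod e1 e2 => eval f e1 y * eval f e2 y
  | Density => f (y cn)
  end.

(** [c] is the Taylor series of the density function at [Y cn 0]. *)
Fixpoint eval_PS (c : nat -> R) (e : expr) (Y : coord -> nat -> R)
  : nat -> R :=
  match e with
  | Const r => PS_scal r PS_one
  | Coord i => Y i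
  | Sum e1 e2 => PS_plus (eval_PS c e1 Y) (eval_PS c e2 Y)
  | Prod e1 e2 => PS_mult (eval_PS c e1 Y) (eval_PS c e2 Y)
  | Density => PS_comp c (Y cn)
  end.

Lemma coord_uniform (P : coord -> R -> Prop) :
  (forall i C D, C <= D -> P i C -> P i D) ->
  (forall i, exists C, P i C) -> exists C, forall i, P i C.
Proof.
  intros Hmono HP.
  destruct (HP cn) as [C1 H1], (HP ca) as [C2 H2],
           (HP cA) as [C3 H3], (HP cB) as [C4 H4].
  exists (Rmax (Rmax C1 C2) (Rmax C3 C4)).
  pose proof (Rmax_l C1 C2). pose proof (Rmax_r C1 C2).
  pose proof (Rmax_l C3 C4). pose proof (Rmax_r C3 C4).
  pose proof (Rmax_l (Rmax C1 C2) (Rmax C3 C4)).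
  pose proof (Rmax_r (Rmax C1 C2) (Rmax C3 C4)).
  intros []; [apply Hmono with C1 | apply Hmono with C2
             | apply Hmono with C3 | apply Hmono with C4]; assumption || lra.
Qed.

Lemma PS_mult_local (a a' b b' : nat -> R) (k : nat) :
  (forall j, (j <= k)%nat -> a j = a' j) ->
  (forall j, (j <= k)%nat -> b j = b' j) ->
  PS_mult a b k = PS_mult a' b' k.
Proof.
  intros Ha Hb. apply sum_eq. intros i Hi.
  rewrite Ha, Hb by lia. reflexivity.
Qed.

Lemma PS_pow_local (u v : nat -> R) (m k : nat) :
  (forall j, (j <= k)%nat -> u j = v j) -> PS_pow u m k = PS_pow v m k.
Proof.
  revert k. induction m as [|m IH]; intros k H; [reflexivity|].
  simpl. apply PS_mult_local; [exact H|].
  intros j Hj. apply IH. intros; apply H; lia.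
Qed.

Lemma eval_PS_local (c : nat -> R) (e : expr) (Y Z : coord -> nat -> R)
  (k : nat) :
  (forall i j, (j <= k)%nat -> Y i j = Z i j) ->
  eval_PS c e Y k = eval_PS c e Z k.
Proof.
  revert k. induction e as [r|i|e1 IH1 e2 IH2|e1 IH1 e2 IH2|];
    intros k H; simpl.
  - reflexivity.
  - apply H; lia.
  - unfold PS_plus. rewrite IH1, IH2 by exact H. reflexivity.
  - apply PS_mult_local; intros; [apply IH1 | apply IH2];
      intros; apply H; lia.
  - apply sum_eq. intros m Hm. f_equal. apply PS_pow_local.
    intros [|j] Hj; [reflexivity | apply H; lia].
Qed.

Section PowerSeriesSolution.

Variables (f : R -> R) (F : coord -> expr) (y0 : state).
Variables (c : nat -> R) (r M : R).
Hypothesis (Hr : 0 < r) (Hc : forall m, Rabs (c m) * r ^ m <= M).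
Hypothesis (Hf : forall z, Rabs z < r -> is_pseries c z (f (y0 cn + z))).

Let d := r / 16.

Definition small_from (rho : R) (Y : coord -> nat -> R) : Prop :=
  forall i, Y i 0%nat = y0 i /\ majorized d rho (PS_tail (Y i)).

Lemma eval_PS_majorized (e : expr) :
  exists C, forall rho Y, 0 < rho -> small_from rho Y ->
    majorized C rho (eval_PS c e Y).
Proof.
  assert (Hd : 0 <= d) by (unfold d; lra).
  induction e as [x|i|e1 [C1 IH1] e2 [C2 IH2]|e1 [C1 IH1] e2 [C2 IH2]|].
  - exists (Rabs x). intros rho Y Hrho _ k.
    change (Rabs (x * PS_one k) <= Rabs x * weight rho k).
    rewrite Rabs_mult. apply Rmult_le_compat_l; [apply Rabs_pos|].
    pose proof (PS_one_majorized rho Hrho k). lra.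
  - exists (Rabs (y0 i) + d). intros rho Y Hrho HY k.
    destruct (HY i) as [H0 Ht]. simpl. destruct k as [|k].
    + rewrite H0. unfold weight. simpl. lra.
    + specialize (Ht (S k)). simpl in Ht.
      pose proof (weight_pos rho (S k) Hrho). pose proof (Rabs_pos (y0 i)).
      nra.
  - exists (C1 + C2). intros rho Y Hrho HY.
    apply majorized_plus; [apply IH1 | apply IH2]; assumption.
  - exists (8 * C1 * C2). intros rho Y Hrho HY.
    apply majorized_mult; [exact Hrho | apply IH1 | apply IH2]; assumption.
  - exists (2 * M). intros rho Y Hrho HY.
    apply (PS_comp_majorized c (Y cn) M r d rho); try assumption.
    + apply HY.
    + unfold d. lra.
Qed.

Lemma PSeries_head (a : nat -> R) (C rho t : R) :
  0 < rho -> majorized C rho (PS_tail a) -> rho * Rabs t <= / 2 ->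
  PSeries a t = a 0%nat + PSeries (PS_tail a) t.
Proof.
  intros Hrho Ha Ht.
  rewrite <- (Rmult_1_r (a 0%nat)), <- (PSeries_PS_one t), <- PSeries_scal.
  rewrite <- PSeries_plus.
  - apply PSeries_ext. intros [|k]; unfold PS_plus, PS_scal, plus, scal; simpl;
      unfold mult; simpl; ring.
  - apply CV_radius_inside.
    apply (majorized_inside (Rabs (a 0%nat)) rho); [exact Hrho| |exact Ht].
    intros k. unfold PS_scal, scal; simpl; unfold mult; simpl.
    rewrite Rabs_mult. apply Rmult_le_compat_l; [apply Rabs_pos|].
    pose proof (PS_one_majorized rho Hrho k). lra.
  - apply CV_radius_inside. exact (majorized_inside _ _ _ _ Hrho Ha Ht).
Qed.

Lemma PSeries_eval_PS (e : expr) (rho t : R) (Y : coord -> nat -> R) :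
  0 < rho -> small_from rho Y -> rho * Rabs t <= / 2 ->
  PSeries (eval_PS c e Y) t = eval f e (fun i => PSeries (Y i) t).
Proof.
  intros Hrho HY Ht.
  assert (Hin : forall e', Rbar_lt (Rabs t) (CV_radius (eval_PS c e' Y))).
  { intros e'. destruct (eval_PS_majorized e') as [C HC].
    exact (majorized_inside C rho t _ Hrho (HC rho Y Hrho HY) Ht). }
  induction e as [x|i|e1 IH1 e2 IH2|e1 IH1 e2 IH2|]; simpl.
  - rewrite PSeries_scal, PSeries_PS_one. ring.
  - reflexivity.
  - rewrite PSeries_plus, IH1, IH2; auto using CV_radius_inside.
  - rewrite PSeries_mult, IH1, IH2; auto.
  - destruct (HY cn) as [H0 Hmaj].
    assert (Hd : 16 * d <= r) by (unfold d; lra).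
    pose proof (is_pseries_PS_comp c (Y cn) M r d rho Hrho
                  ltac:(unfold d; lra) Hc Hmaj Hd t Ht) as Hcomp.
    rewrite (PSeries_head _ _ _ _ Hrho Hmaj Ht), H0.
    rewrite <- (is_pseries_unique _ _ _ Hcomp).
    apply is_pseries_unique, Hf.
    pose proof (majorized_PSeries_le _ _ _ _ Hrho Hmaj Ht).
    unfold d in *; lra.
Qed.

(** The [N]-th iterate has the first [N + 1] coefficients of the solution. *)
Fixpoint PS_iterate (N : nat) (i : coord) (k : nat) : R :=
  match k with
  | O => y0 i
  | S k =>
      match N with
      | O => 0
      | S N => eval_PS c (F i) (PS_iterate N) k / INR (S k)
      end
  end.

Definition PS_solution (i : coord) (k : nat) : R := PS_iterate k i k.

Lemma PS_iterate_stable (N : nat) (i : coord) (k : nat) :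
  (k <= N)%nat -> PS_iterate N i k = PS_solution i k.
Proof.
  assert (Hstep : forall N i k, (k <= N)%nat ->
            PS_iterate (S N) i k = PS_iterate N i k).
  { clear N i k. intros N. induction N as [|N IH]; intros i [|k] Hk;
      try lia; try reflexivity.
    change (eval_PS c (F i) (PS_iterate (S N)) k / INR (S k)
            = eval_PS c (F i) (PS_iterate N) k / INR (S k)).
    f_equal. apply eval_PS_local. intros i' j Hj. apply IH. lia. }
  intros Hk. unfold PS_solution. induction Hk as [|N Hk IH]; [reflexivity|].
  rewrite Hstep by exact Hk. exact IH.
Qed.

Lemma PS_solution_succ (i : coord) (k : nat) :
  INR (S k) * PS_solution i (S k) = eval_PS c (F i) PS_solution k.
Proof.
  change (PS_solution i (S k))
    with (eval_PS c (F i) (PS_iterate k) k / INR (S k)).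
  rewrite (eval_PS_local c (F i) (PS_iterate k) PS_solution k)
    by (intros; apply PS_iterate_stable; lia).
  field. apply not_0_INR. lia.
Qed.

(** Integration divides the [k]-th coefficient by [k + 1]; a large [rho] turns
    this into a bound by [d] of all the coefficients of the solution. *)
Lemma PS_solution_small :
  exists rho, 0 < rho /\ small_from rho PS_solution.
Proof.
  assert (Hdpos : 0 < d) by (unfold d; lra).
  destruct (coord_uniform (fun i C => forall rho Y, 0 < rho ->
              small_from rho Y -> majorized C rho (eval_PS c (F i) Y)))
    as [C HC].
  { intros i C D HCD H rho Y Hrho HY.
    apply majorized_le with C; auto. }
  { intros i. apply eval_PS_majorized. }
  set (rho := 1 + 4 * Rabs C / d).
  assert (Hq : 0 <= 4 * Rabs C / d).
  { apply Rdiv_le_0_compat; [|exact Hdpos]. pose proof (Rabs_pos C). lra. }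
  assert (Hrho : 0 < rho) by (unfold rho; lra).
  assert (HCrho : 4 * C <= d * rho).
  { unfold rho. rewrite Rmult_plus_distr_l.
    replace (d * (4 * Rabs C / d)) with (4 * Rabs C) by (field; lra).
    pose proof (Rle_abs C). lra. }
  assert (Hiter : forall N, small_from rho (PS_iterate N)).
  { induction N as [|N IH]; intros i; (split; [reflexivity|]).
    - intros [|k]; simpl; rewrite Rabs_R0; apply Rmult_le_pos;
        try apply Rlt_le, weight_pos; lra.
    - intros [|k].
      { simpl. rewrite Rabs_R0. apply Rmult_le_pos;
          try apply Rlt_le, weight_pos; lra. }
      change (Rabs (eval_PS c (F i) (PS_iterate N) k / INR (S k))
              <= d * weight rho (S k)).
      pose proof (HC i rho _ Hrho IH k) as Hk.
      pose proof (pos_INR k) as Hk0.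
      unfold Rdiv. rewrite Rabs_mult, S_INR.
      rewrite (Rabs_pos_eq (/ (INR k + 1)))
        by (apply Rlt_le, Rinv_0_lt_compat; lra).
      apply Rle_trans with (C * weight rho k * / (INR k + 1)).
      { apply Rmult_le_compat_r; [|exact Hk].
        apply Rlt_le, Rinv_0_lt_compat; lra. }
      unfold weight. rewrite S_INR. simpl (rho ^ S k).
      assert (Hp : 0 < rho ^ k) by (apply pow_lt; exact Hrho).
      set (x := INR k + 1) in *. assert (Hx : 1 <= x) by (unfold x; lra).
      replace (C * (rho ^ k / x ^ 2) * / x)
        with (rho ^ k * (C * (x + 1) ^ 2) * / (x ^ 3 * (x + 1) ^ 2))
        by (field; lra).
      replace (d * (rho * rho ^ k / (x + 1) ^ 2))
        with (rho ^ k * (d * rho * x ^ 3) * / (x ^ 3 * (x + 1) ^ 2))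
        by (field; lra).
      apply Rmult_le_compat_r.
      { apply Rlt_le, Rinv_0_lt_compat, Rmult_lt_0_compat; apply pow_lt; lra. }
      apply Rmult_le_compat_l; [lra|].
      assert (H4 : (x + 1) ^ 2 <= 4 * x ^ 3) by nra.
      assert (Hx3 : 0 <= x ^ 3) by (apply pow_le; lra).
      destruct (Rle_dec 0 C) as [HC0|HC0].
      + apply Rle_trans with (C * (4 * x ^ 3)).
        * apply Rmult_le_compat_l; assumption.
        * replace (C * (4 * x ^ 3)) with (4 * C * x ^ 3) by ring.
          apply Rmult_le_compat_r; assumption.
      + apply Rle_trans with 0.
        * assert (0 <= (x + 1) ^ 2) by (apply pow_le; lra). nra.
        * apply Rmult_le_pos; [|exact Hx3]. apply Rmult_le_pos; lra. }
  exists rho. split; [exact Hrho|].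
  intros i. split; [reflexivity|]. intros k.
  destruct (Hiter k i) as [_ H]. specialize (H k).
  destruct k; exact H.
Qed.

End PowerSeriesSolution.

Lemma analytic_at_coef_bound (f : R -> R) (x0 : R) :
  analytic_at f x0 ->
  exists c r M, 0 < r /\ (forall m, Rabs (c m) * r ^ m <= M) /\
    forall z, Rabs z < r -> is_pseries c z (f (x0 + z)).
Proof.
  intros (c & r & Hr & Hc).
  assert (Hhalf : is_pseries c (r / 2) (f (x0 + r / 2))).
  { replace (r / 2) with (x0 + r / 2 - x0) at 1 by ring.
    apply Hc. rewrite Rabs_pos_eq; lra. }
  apply is_pseries_R in Hhalf.
  destruct (filterlim_bounded (K := R_AbsRing) (V := R_NormedModule)
              (fun m => c m * (r / 2) ^ m)) as [M HM].
  { exists 0. apply ex_series_lim_0. eexists. exact Hhalf. }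
  exists c, (r / 2), M. split; [lra|]. split.
  - intros m. specialize (HM m). unfold norm in HM. simpl in HM.
    unfold abs in HM. simpl in HM.
    rewrite Rabs_mult, (Rabs_pos_eq ((r / 2) ^ m)) in HM
      by (apply pow_le; lra). exact HM.
  - intros z Hz. replace z with (x0 + z - x0) at 1 by ring.
    apply Hc. replace (x0 + z - x0) with z by ring. lra.
Qed.

(** With two-sided derivatives around [t0]; a solution for
    [0 <= t < T] is obtained on a slightly larger interval, so that no one-sided
    calculus is needed to construct it. *)
Lemma local_analytic_solution (f : R -> R) (F : coord -> expr) (y0 : state)
  (t0 : R) :
  analytic_at f (y0 cn) ->
  exists h y, 0 < h /\ (forall i, y t0 i = y0 i) /\
    (forall i, analytic_at (fun t => y t i) t0) /\
    forall t, Rabs (t - t0) < h ->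
      forall i, is_derive (fun s => y s i) t (eval f (F i) (y t)).
Proof.
  intros Hf. destruct (analytic_at_coef_bound f _ Hf)
    as (c & r & M & Hr & Hc & Hfc).
  destruct (PS_solution_small F y0 c r M Hr Hc) as (rho & Hrho & HY).
  set (Y := PS_solution F y0 c) in *.
  assert (Hhalf : forall t, Rabs t < / (2 * rho) -> rho * Rabs t <= / 2).
  { intros t Ht. apply Rlt_le, Rmult_lt_reg_l with (/ rho).
    - apply Rinv_0_lt_compat, Hrho.
    - replace (/ rho * (rho * Rabs t)) with (Rabs t) by (field; lra).
      replace (/ rho * / 2) with (/ (2 * rho)) by (field; lra). exact Ht. }
  assert (Hin : forall t i, Rabs t < / (2 * rho) ->
            Rbar_lt (Rabs t) (CV_radius (Y i))).
  { intros t i Ht.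
    destruct (eval_PS_majorized y0 c r M Hr Hc (Coord i)) as [C HC].
    exact (majorized_inside C rho t _ Hrho (HC rho Y Hrho HY) (Hhalf t Ht)). }
  exists (/ (2 * rho)), (fun t i => PSeries (Y i) (t - t0)).
  assert (Hh : 0 < / (2 * rho)) by (apply Rinv_0_lt_compat; lra).
  split; [exact Hh|]. split; [|split].
  - intros i. rewrite Rminus_diag, PSeries_0. apply (HY i).
  - intros i. exists (Y i), (/ (2 * rho)). split; [exact Hh|].
    intros t Ht. apply PSeries_correct, CV_radius_inside, Hin, Ht.
  - intros t Ht i.
    rewrite <- (PSeries_eval_PS f y0 c r M Hr Hc Hfc (F i) rho (t - t0) Y Hrho
                  HY (Hhalf _ Ht)).
    rewrite <- (PSeries_ext (PS_derive (Y i)))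
      by (intros k; apply PS_solution_succ).
    evar_last.
    + apply (is_derive_comp (PSeries (Y i)) (fun s => s - t0)).
      * apply is_derive_PSeries, Hin, Ht.
      * auto_derive; [exact I | reflexivity].
    + unfold scal; simpl; unfold mult; simpl. ring.
Qed.

(** * Elementary calculus *)

Lemma increasing_of_derive (g g' : R -> R) (a b : R) :
  a <= b -> (forall t, a <= t <= b -> is_derive g t (g' t)) ->
  (forall t, a < t < b -> 0 <= g' t) -> g a <= g b.
Proof.
  intros Hab Hg Hpos. destruct Hab as [Hab| ->]; [|lra].
  destruct (MVT_cor2 g g' a b Hab) as (x & Hx & Hin).
  { intros t Ht. apply is_derive_Reals, Hg, Ht. }
  specialize (Hpos x Hin). nra.
Qed.

Lemma decreasing_of_derive (g g' : R -> R) (a b : R) :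
  a <= b -> (forall t, a <= t <= b -> is_derive g t (g' t)) ->
  (forall t, a < t < b -> g' t <= 0) -> g b <= g a.
Proof.
  intros Hab Hg Hneg.
  enough (- g a <= - g b) by lra.
  apply (increasing_of_derive (fun t => - g t) (fun t => - g' t)).
  - exact Hab.
  - intros t Ht. exact (is_derive_opp g t (g' t) (Hg t Ht)).
  - intros t Ht. specialize (Hneg t Ht). lra.
Qed.

Lemma lipschitz_of_derive (g g' : R -> R) (a b C s t : R) :
  (forall x, a < x < b -> is_derive g x (g' x)) ->
  (forall x, a < x < b -> Rabs (g' x) <= C) ->
  a < s < b -> a < t < b -> Rabs (g t - g s) <= C * Rabs (t - s).
Proof.
  intros Hg HC.
  assert (H : forall s t, a < s -> t < b -> s <= t ->
            Rabs (g t - g s) <= C * Rabs (t - s)).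
  { clear s t. intros s t Hs Ht [Hst| ->].
    - destruct (MVT_cor2 g g' s t Hst) as (x & -> & Hx).
      { intros x Hx. apply is_derive_Reals, Hg. lra. }
      rewrite Rabs_mult. apply Rmult_le_compat_r; [apply Rabs_pos|].
      apply HC. lra.
    - rewrite !Rminus_diag, Rabs_R0. lra. }
  intros Hs Ht. destruct (Rle_dec s t) as [Hst|Hst].
  - apply H; lra.
  - rewrite (Rabs_minus_sym (g t)), (Rabs_minus_sym t). apply H; lra.
Qed.

Lemma continuous_eps (g : R -> R) (x eps : R) :
  continuous g x -> 0 < eps ->
  exists delta, 0 < delta /\
    forall t, Rabs (t - x) < delta -> Rabs (g t - g x) < eps.
Proof.
  intros Hg Heps.
  destruct (proj1 (filterlim_locally g (g x)) Hg (mkposreal eps Heps))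
    as [[d Hd] Hnear].
  exists d. split; [exact Hd|]. intros t Ht. exact (Hnear t Ht).
Qed.

Lemma eps_continuous (g : R -> R) (x : R) :
  (forall eps, 0 < eps -> exists delta, 0 < delta /\
     forall t, Rabs (t - x) < delta -> Rabs (g t - g x) < eps) ->
  continuous g x.
Proof.
  intros H. apply filterlim_locally. intros [eps Heps].
  destruct (H eps Heps) as (d & Hd & Hg).
  exists (mkposreal d Hd). intros t Ht. exact (Hg t Ht).
Qed.

Lemma is_derive_continuous (g : R -> R) (x l : R) :
  is_derive g x l -> continuous g x.
Proof.
  intros H. apply (ex_derive_continuous g). exists l. exact H.
Qed.

Lemma is_derive_ext_near (g k : R -> R) (x l h : R) :
  0 < h -> (forall t, Rabs (t - x) < h -> g t = k t) ->
  is_derive g x l -> is_derive k x l.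
Proof.
  intros Hh E. apply is_derive_ext_loc.
  exists (mkposreal h Hh). intros t Ht. apply E. exact Ht.
Qed.

Lemma is_derive_at_limit (g G : R -> R) (x h : R) :
  0 < h -> continuous g x -> continuous G x ->
  (forall t, t <> x -> Rabs (t - x) < h -> is_derive g t (G t)) ->
  is_derive g x (G x).
Proof.
  intros Hh Hg HG Hder. apply is_derive_Reals. intros eps Heps.
  destruct (continuous_eps G x eps HG Heps) as (d & Hd & Hclose).
  assert (Hm : 0 < Rmin d h) by (apply Rmin_pos; assumption).
  exists (mkposreal _ Hm). simpl. intros k Hk0 Hk.
  pose proof (Rmin_l d h). pose proof (Rmin_r d h).
  assert (Hnear : forall t, Rmin x (x + k) <= t <= Rmax x (x + k) ->
            Rabs (t - x) <= Rabs k).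
  { intros t. unfold Rmin, Rmax, Rabs.
    destruct (Rle_dec x (x + k)); destruct (Rcase_abs (t - x));
      destruct (Rcase_abs k); lra. }
  destruct (MVT_gen g x (x + k) G) as (c & Hc & E).
  - intros t Ht. apply Hder.
    + intros ->. revert Ht. unfold Rmin, Rmax.
      destruct (Rle_dec x (x + k)); lra.
    + specialize (Hnear t). lra.
  - intros t Ht. apply continuity_pt_filterlim.
    destruct (Req_dec t x) as [->|Hne]; [exact Hg|].
    apply (is_derive_continuous g t (G t)), Hder; [exact Hne|].
    specialize (Hnear t). lra.
  - rewrite E. replace (x + k - x) with k by ring.
    unfold Rdiv. rewrite Rmult_assoc, Rinv_r, Rmult_1_r by exact Hk0.
    apply Hclose. specialize (Hnear c Hc). lra.
Qed.

(** Both [D e^{K t}] and [D e^{- K t}] are monotone, and vanish at [t0]. *)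
Lemma gronwall_zero (D D' : R -> R) (K t0 h : R) :
  (forall t, Rabs (t - t0) < h -> is_derive D t (D' t)) ->
  (forall t, Rabs (t - t0) < h -> 0 <= D t /\ Rabs (D' t) <= K * D t) ->
  D t0 = 0 -> forall t, Rabs (t - t0) < h -> D t = 0.
Proof.
  intros Hder Hle H0 t Ht.
  assert (Hexp : forall k s, Rabs (s - t0) < h ->
            is_derive (fun s => D s * exp (k * s)) s
              ((D' s + k * D s) * exp (k * s))).
  { intros k s Hs. pose proof (Hder s Hs) as Hs'.
    auto_derive.
    - exists (D' s). exact Hs'.
    - replace (Derive (fun x : R => D x) s) with (D' s)
        by (symmetry; apply is_derive_unique; exact Hs').
      ring. }
  assert (Hexp0 : forall x, 0 < exp x) by exact exp_pos.
  assert (Hfin : forall k, D t * exp (k * t) <= D t0 * exp (k * t0) -> D t = 0).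
  { intros k Hk. rewrite H0, Rmult_0_l in Hk.
    destruct (Hle t Ht) as [Hpos _]. specialize (Hexp0 (k * t)). nra. }
  destruct (Rle_dec t0 t) as [Htt|Htt].
  - apply (Hfin (- K)).
    apply (decreasing_of_derive (fun s => D s * exp (- K * s))
             (fun s => (D' s + - K * D s) * exp (- K * s))); [exact Htt| |].
    + intros s Hs. apply Hexp. revert Ht. unfold Rabs.
      destruct (Rcase_abs (t - t0)), (Rcase_abs (s - t0)); lra.
    + intros s Hs. destruct (Hle s) as [_ H].
      { revert Ht. unfold Rabs.
        destruct (Rcase_abs (t - t0)), (Rcase_abs (s - t0)); lra. }
      pose proof (Rle_abs (D' s)). specialize (Hexp0 (- K * s)). nra.
  - apply (Hfin K).
    apply (increasing_of_derive (fun s => D s * exp (K * s))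
             (fun s => (D' s + K * D s) * exp (K * s))); [lra| |].
    + intros s Hs. apply Hexp. revert Ht. unfold Rabs.
      destruct (Rcase_abs (t - t0)), (Rcase_abs (s - t0)); lra.
    + intros s Hs. destruct (Hle s) as [_ H].
      { revert Ht. unfold Rabs.
        destruct (Rcase_abs (t - t0)), (Rcase_abs (s - t0)); lra. }
      pose proof (Rle_abs (- D' s)). rewrite Rabs_Ropp in *.
      specialize (Hexp0 (K * s)). nra.
Qed.

Lemma real_induction (P : R -> Prop) (a b : R) :
  P a ->
  (forall x, a < x <= b -> (forall s, a <= s < x -> P s) -> P x) ->
  (forall x, a <= x < b -> P x ->
     exists d, 0 < d /\ forall s, x < s < x + d -> P s) ->
  forall x, a <= x <= b -> P x.
Proof.
  intros Ha Hclosed Hopen x Hx.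
  set (E := fun t => a <= t <= b /\ forall s, a <= s <= t -> P s).
  destruct (completeness E) as [m [Hub Hlub]].
  { exists b. intros t [Ht _]. lra. }
  { exists a. split; [lra|]. intros s Hs. replace s with a by lra. exact Ha. }
  assert (Ham : a <= m).
  { apply Hub. split; [lra|]. intros s Hs. replace s with a by lra. exact Ha. }
  assert (Hmb : m <= b) by (apply Hlub; intros t [Ht _]; lra).
  assert (Hbelow : forall s, a <= s < m -> P s).
  { intros s Hs. destruct (classic (exists t, E t /\ s < t)) as [(t & Et & Hst)|H].
    - apply Et. lra.
    - exfalso. enough (m <= s) by lra. apply Hlub. intros t Et.
      destruct (Rle_dec t s) as [|Hn]; [assumption|].
      exfalso. apply H. exists t. split; [exact Et|lra]. }
  assert (Hm : P m).
  { destruct (Req_dec a m) as [<-|Hne]; [exact Ha|].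
    apply Hclosed; [lra | exact Hbelow]. }
  destruct (Rlt_dec m b) as [Hlt|Hge].
  - exfalso. destruct (Hopen m (conj Ham Hlt) Hm) as (d & Hd & Hext).
    set (t := Rmin b (m + d / 2)).
    assert (Htm : m < t) by (unfold t, Rmin; destruct (Rle_dec _ _); lra).
    assert (Htb : t <= b) by apply Rmin_l.
    assert (Htd : t <= m + d / 2) by apply Rmin_r.
    enough (t <= m) by lra. apply Hub. split; [lra|].
    intros s Hs. destruct (Rlt_dec s m); [apply Hbelow; lra|].
    destruct (Req_dec s m) as [->|]; [exact Hm | apply Hext; lra].
  - destruct (Rlt_dec x m) as [|]; [apply Hbelow; lra|].
    replace x with m by lra. exact Hm.
Qed.

(** The supremum of the times at which [g <= c] belongs to them by
    continuity. *)
Lemma last_below (g : R -> R) (a b c : R) :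
  a <= b -> (forall t, a <= t <= b -> continuous g t) ->
  g a <= c -> c < g b ->
  exists t, a <= t < b /\ g t <= c /\ forall s, t < s <= b -> c < g s.
Proof.
  intros Hab Hg Ha Hb.
  set (E := fun t => a <= t <= b /\ g t <= c).
  destruct (completeness E) as [m [Hub Hlub]].
  { exists b. intros t [Ht _]. lra. }
  { exists a. split; lra. }
  assert (Ham : a <= m) by (apply Hub; split; lra).
  assert (Hmb : m <= b) by (apply Hlub; intros t [Ht _]; lra).
  assert (Hm : g m <= c).
  { apply Rnot_lt_le. intros Hlt.
    destruct (continuous_eps g m (g m - c) (Hg m (conj Ham Hmb)) ltac:(lra))
      as (d & Hd & Hnear).
    enough (m <= m - d) by lra. apply Hlub. intros t [Ht Hgt].
    apply Rnot_lt_le. intros Htd. specialize (Hub t (conj Ht Hgt)).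
    specialize (Hnear t). rewrite (Rabs_left1 (t - m)) in Hnear by lra.
    specialize (Hnear ltac:(lra)). apply Rabs_def2 in Hnear. lra. }
  exists m. split; [|split].
  - split; [exact Ham|]. destruct Hmb as [|E']; [assumption|].
    rewrite E' in Hm. lra.
  - exact Hm.
  - intros s Hs. apply Rnot_le_lt. intros Hle.
    enough (s <= m) by lra. apply Hub. split; lra.
Qed.

Lemma left_limit_of_lipschitz (g : R -> R) (a b C : R) :
  a < b ->
  (forall s t, a < s < b -> a < t < b -> Rabs (g t - g s) <= C * Rabs (t - s)) ->
  exists l, filterlim g (at_left b) (locally l).
Proof.
  intros Hab HC.
  apply (filterlim_locally_cauchy (U := R_CompleteSpace)).
  intros [eps Heps]. pose proof (Rabs_pos C) as HC0.
  set (d := Rmin (b - a) (eps / (Rabs C + 1))).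
  assert (Hd : 0 < d).
  { apply Rmin_pos; [lra|]. apply Rdiv_lt_0_compat; lra. }
  exists (fun t => b - d < t < b). split.
  - exists (mkposreal d Hd). intros t Ht Htb.
    change (Rabs (t - b) < d) in Ht. apply Rabs_def2 in Ht. simpl in Ht. lra.
  - intros s t Hs Ht. change (Rabs (g t - g s) < eps).
    assert (Hda : d <= b - a) by apply Rmin_l.
    assert (Hde : d <= eps / (Rabs C + 1)) by apply Rmin_r.
    eapply Rle_lt_trans; [apply HC; lra|].
    assert (Hts : Rabs (t - s) < d) by (apply Rabs_def1; lra).
    apply Rle_lt_trans with ((Rabs C + 1) * Rabs (t - s)).
    { apply Rmult_le_compat_r; [apply Rabs_pos|].
      pose proof (Rle_abs C). lra. }
    apply Rlt_le_trans with ((Rabs C + 1) * d).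
    { apply Rmult_lt_compat_l; lra. }
    apply Rle_trans with ((Rabs C + 1) * (eps / (Rabs C + 1))).
    { apply Rmult_le_compat_l; lra. }
    right. field. lra.
Qed.

Lemma filterlim_at_left_eps (g : R -> R) (b l eps : R) :
  filterlim g (at_left b) (locally l) -> 0 < eps ->
  exists d, 0 < d /\ forall t, b - d < t < b -> Rabs (g t - l) < eps.
Proof.
  intros H Heps.
  pose proof (proj1 (filterlim_locally g l) H (mkposreal eps Heps))
    as [[d Hd] Hg].
  exists d. split; [exact Hd|]. intros t Ht. apply Hg; [|lra].
  change (Rabs (t - b) < d). apply Rabs_def1; lra.
Qed.

(** * Analytic functions of one variable *)

Lemma analytic_at_ext_near (g k : R -> R) (x h : R) :
  0 < h -> (forall t, Rabs (t - x) < h -> g t = k t) ->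
  analytic_at g x -> analytic_at k x.
Proof.
  intros Hh E (c & r & Hr & Hc). exists c, (Rmin r h).
  split; [apply Rmin_pos; assumption|]. intros t Ht.
  pose proof (Rmin_l r h). pose proof (Rmin_r r h).
  rewrite <- E by lra. apply Hc. lra.
Qed.

Lemma analytic_at_derive (g : R -> R) (x : R) :
  analytic_at g x ->
  exists r g', 0 < r /\ continuous g' x /\
    forall t, Rabs (t - x) < r -> is_derive g t (g' t).
Proof.
  intros (c & r & Hr & Hc).
  assert (Hrad : forall t, Rabs t < r -> Rbar_lt (Rabs t) (CV_radius c)).
  { intros t Ht. set (s := (Rabs t + r) / 2). pose proof (Rabs_pos t).
    assert (Hs : Rabs s < r) by (unfold s; rewrite Rabs_pos_eq; lra).
    apply Rbar_lt_le_trans with (Rabs s).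
    { simpl. unfold s. rewrite (Rabs_pos_eq ((Rabs t + r) / 2)); lra. }
    apply Rbar_not_lt_le. intros Hout. apply (CV_disk_outside c s Hout).
    apply ex_series_lim_0. exists (g (x + s)).
    apply is_pseries_R. replace s with (x + s - x) at 1 by ring.
    apply Hc. replace (x + s - x) with s by ring. exact Hs. }
  exists r, (fun t => PSeries (PS_derive c) (t - x)). split; [exact Hr|]. split.
  - apply (continuous_comp (fun t => t - x) (PSeries (PS_derive c))).
    + apply (is_derive_continuous _ _ 1). auto_derive; [exact I | ring].
    + apply continuity_pt_filterlim, PSeries_continuity.
      rewrite CV_radius_derive. apply Hrad.
      rewrite Rminus_diag, Rabs_R0. exact Hr.
  - intros t Ht.
    apply (is_derive_ext_near (fun s => PSeries c (s - x)) g t _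
             (r - Rabs (t - x))); [lra| |].
    + intros s Hs. apply is_pseries_unique, Hc.
      replace (s - x) with (s - t + (t - x)) by ring.
      eapply Rle_lt_trans; [apply Rabs_triang|]. lra.
    + evar_last.
      * apply (is_derive_comp (PSeries c) (fun s => s - x)).
        -- apply is_derive_PSeries, Hrad, Ht.
        -- auto_derive; [exact I | reflexivity].
      * unfold scal; simpl; unfold mult; simpl. ring.
Qed.

Lemma analytic_at_continuous (g : R -> R) (x : R) :
  analytic_at g x -> continuous g x.
Proof.
  intros H. destruct (analytic_at_derive g x H) as (r & g' & Hr & _ & Hg).
  apply (is_derive_continuous g x (g' x)), Hg.
  rewrite Rminus_diag, Rabs_R0. exact Hr.
Qed.

Lemma analytic_at_lipschitz (g : R -> R) (x : R) :
  analytic_at g x ->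
  exists L d, 0 < d /\ forall s t, Rabs (s - x) < d -> Rabs (t - x) < d ->
    Rabs (g s - g t) <= L * Rabs (s - t).
Proof.
  intros H. destruct (analytic_at_derive g x H) as (r & g' & Hr & Hc & Hg).
  destruct (continuous_eps g' x 1 Hc Rlt_0_1) as (d & Hd & Hnear).
  exists (Rabs (g' x) + 1), (Rmin r d).
  split; [apply Rmin_pos; assumption|].
  pose proof (Rmin_l r d). pose proof (Rmin_r r d).
  assert (Hin : forall t, Rabs (t - x) < Rmin r d
            <-> x - Rmin r d < t < x + Rmin r d).
  { intros t. split; intros Ht; [apply Rabs_def2 in Ht; lra|].
    apply Rabs_def1; lra. }
  intros s t Hs Ht. apply Hin in Hs, Ht.
  apply (lipschitz_of_derive g g' (x - Rmin r d) (x + Rmin r d));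
    try assumption; intros u Hu; apply Hin in Hu.
  - apply Hg. lra.
  - specialize (Hnear u ltac:(lra)).
    replace (g' u) with (g' x + (g' u - g' x)) by ring.
    eapply Rle_trans; [apply Rabs_triang|]. lra.
Qed.

(** * Uniqueness, continuation and maximal solutions *)

Definition dist1 (u v : state) : R :=
  Rabs (u cn - v cn) + Rabs (u ca - v ca)
  + Rabs (u cA - v cA) + Rabs (u cB - v cB).

Lemma coord_le_dist1 (u v : state) (i : coord) : Rabs (u i - v i) <= dist1 u v.
Proof.
  unfold dist1. pose proof (Rabs_pos (u cn - v cn)).
  pose proof (Rabs_pos (u ca - v ca)). pose proof (Rabs_pos (u cA - v cA)).
  pose proof (Rabs_pos (u cB - v cB)). destruct i; lra.
Qed.

Lemma dist1_pos (u v : state) : 0 <= dist1 u v.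
Proof. eapply Rle_trans; [apply Rabs_pos | apply (coord_le_dist1 u v cn)]. Qed.

Lemma eval_lipschitz (f : R -> R) (e : expr) (y0 : state) :
  analytic_at f (y0 cn) ->
  exists L d, 0 <= L /\ 0 < d /\ forall u v,
    (forall i, Rabs (u i - y0 i) < d) -> (forall i, Rabs (v i - y0 i) < d) ->
    Rabs (eval f e u - eval f e v) <= L * dist1 u v.
Proof.
  intros Hf.
  induction e as [r|i|e1 (L1 & d1 & HL1 & Hd1 & H1) e2 (L2 & d2 & HL2 & Hd2 & H2)
                 |e1 (L1 & d1 & HL1 & Hd1 & H1) e2 (L2 & d2 & HL2 & Hd2 & H2)|];
    simpl.
  - exists 0, 1. split; [lra|]. split; [lra|]. intros.
    rewrite Rminus_diag, Rabs_R0. lra.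
  - exists 1, 1. split; [lra|]. split; [lra|]. intros.
    rewrite Rmult_1_l. apply coord_le_dist1.
  - exists (L1 + L2), (Rmin d1 d2). split; [lra|].
    split; [apply Rmin_pos; assumption|]. intros u v Hu Hv.
    pose proof (Rmin_l d1 d2). pose proof (Rmin_r d1 d2).
    specialize (H1 u v ltac:(intros i; specialize (Hu i); lra)
                       ltac:(intros i; specialize (Hv i); lra)).
    specialize (H2 u v ltac:(intros i; specialize (Hu i); lra)
                       ltac:(intros i; specialize (Hv i); lra)).
    replace (eval f e1 u + eval f e2 u - (eval f e1 v + eval f e2 v))
      with (eval f e1 u - eval f e1 v + (eval f e2 u - eval f e2 v)) by ring.
    eapply Rle_trans; [apply Rabs_triang|]. lra.
  - set (d := Rmin (Rmin d1 d2) 1).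
    assert (Hd : 0 < d) by (repeat apply Rmin_pos; lra).
    assert (Hdd : d <= d1 /\ d <= d2 /\ d <= 1).
    { unfold d. pose proof (Rmin_l (Rmin d1 d2) 1).
      pose proof (Rmin_r (Rmin d1 d2) 1).
      pose proof (Rmin_l d1 d2). pose proof (Rmin_r d1 d2). lra. }
    (* within distance 1 in each of the four coordinates, a Lipschitz constant
       [L] bounds the variation of the factor by [4 L] *)
    assert (Hbound : forall e L dd, 0 <= L -> d <= dd ->
      (forall u v, (forall i, Rabs (u i - y0 i) < dd) ->
         (forall i, Rabs (v i - y0 i) < dd) ->
         Rabs (eval f e u - eval f e v) <= L * dist1 u v) ->
      forall u, (forall i, Rabs (u i - y0 i) < d) ->
        Rabs (eval f e u) <= Rabs (eval f e y0) + 4 * L).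
    { intros e L dd HL Hddd H u Hu.
      specialize (H u y0 ltac:(intros i; specialize (Hu i); lra)
                    ltac:(intros i; rewrite Rminus_diag, Rabs_R0; lra)).
      replace (eval f e u) with (eval f e y0 + (eval f e u - eval f e y0))
        by ring.
      eapply Rle_trans; [apply Rabs_triang|].
      enough (L * dist1 u y0 <= L * 4) by lra.
      apply Rmult_le_compat_l; [exact HL|]. unfold dist1.
      pose proof (Hu cn). pose proof (Hu ca). pose proof (Hu cA).
      pose proof (Hu cB). lra. }
    set (K1 := Rabs (eval f e1 y0) + 4 * L1).
    set (K2 := Rabs (eval f e2 y0) + 4 * L2).
    assert (HK1 : 0 <= K1).
    { unfold K1. pose proof (Rabs_pos (eval f e1 y0)). lra. }
    assert (HK2 : 0 <= K2).
    { unfold K2. pose proof (Rabs_pos (eval f e2 y0)). lra. }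
    exists (K1 * L2 + K2 * L1), d.
    split; [apply Rplus_le_le_0_compat; apply Rmult_le_pos; assumption|].
    split; [exact Hd|]. intros u v Hu Hv.
    pose proof (Hbound e1 L1 d1 HL1 ltac:(lra) H1 u Hu) as B1.
    pose proof (Hbound e2 L2 d2 HL2 ltac:(lra) H2 v Hv) as B2.
    specialize (H1 u v ltac:(intros i; specialize (Hu i); lra)
                       ltac:(intros i; specialize (Hv i); lra)).
    specialize (H2 u v ltac:(intros i; specialize (Hu i); lra)
                       ltac:(intros i; specialize (Hv i); lra)).
    replace (eval f e1 u * eval f e2 u - eval f e1 v * eval f e2 v)
      with (eval f e1 u * (eval f e2 u - eval f e2 v)
            + eval f e2 v * (eval f e1 u - eval f e1 v)) by ring.
    eapply Rle_trans; [apply Rabs_triang|]. rewrite !Rabs_mult.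
    replace ((K1 * L2 + K2 * L1) * dist1 u v)
      with (K1 * (L2 * dist1 u v) + K2 * (L1 * dist1 u v)) by ring.
    apply Rplus_le_compat; apply Rmult_le_compat; assumption || apply Rabs_pos.
  - destruct (analytic_at_lipschitz f _ Hf) as (L & d & Hd & HL).
    exists (Rabs L), d. split; [apply Rabs_pos|]. split; [exact Hd|].
    intros u v Hu Hv. eapply Rle_trans; [apply HL; [apply Hu | apply Hv]|].
    apply Rle_trans with (Rabs L * Rabs (u cn - v cn)).
    + apply Rmult_le_compat_r; [apply Rabs_pos | apply Rle_abs].
    + apply Rmult_le_compat_l; [apply Rabs_pos | apply coord_le_dist1].
Qed.

Lemma eval_continuous (f : R -> R) (e : expr) (y : R -> state) (t : R) :
  analytic_at f (y t cn) -> (forall i, continuous (fun s => y s i) t) ->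
  continuous (fun s => eval f e (y s)) t.
Proof.
  intros Hf Hy. induction e as [r|i|e1 IH1 e2 IH2|e1 IH1 e2 IH2|]; simpl.
  - apply continuous_const.
  - apply Hy.
  - exact (continuous_plus (fun s => eval f e1 (y s))
             (fun s => eval f e2 (y s)) t IH1 IH2).
  - exact (continuous_mult (fun s => eval f e1 (y s))
             (fun s => eval f e2 (y s)) t IH1 IH2).
  - apply (continuous_comp (fun s => y s cn) f); [apply Hy|].
    apply analytic_at_continuous, Hf.
Qed.

Lemma coord_uniform_pos (P : coord -> R -> Prop) :
  (forall i c d, 0 < c <= d -> P i d -> P i c) ->
  (forall i, exists d, 0 < d /\ P i d) ->
  exists d, 0 < d /\ forall i, P i d.
Proof.
  intros Hmono HP.
  destruct (coord_uniform (fun i C => 0 < C /\ P i (/ C))) as [C HC].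
  - intros i C D HCD [H0 H]. split; [lra|]. apply Hmono with (/ C); [|exact H].
    split; [apply Rinv_0_lt_compat; lra|]. apply Rinv_le_contravar; lra.
  - intros i. destruct (HP i) as (d & Hd & H). exists (/ d).
    rewrite Rinv_inv. split; [apply Rinv_0_lt_compat, Hd | exact H].
  - exists (/ C). split; [apply Rinv_0_lt_compat, (HC cn) | apply HC].
Qed.

Definition solves (f : R -> R) (F : coord -> expr) (alpha beta : R)
  (y : R -> state) : Prop :=
  forall t, alpha < t < beta ->
    0 < y t cn /\
    forall i, is_derive (fun s => y s i) t (eval f (F i) (y t)).

Lemma solves_continuous (f : R -> R) (F : coord -> expr) (alpha beta t : R)
  (y : R -> state) :
  solves f F alpha beta y -> alpha < t < beta ->
  forall i, continuous (fun s => y s i) t.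
Proof.
  intros Hy Ht i. eapply is_derive_continuous. apply (Hy t Ht).
Qed.

Lemma local_uniqueness (f : R -> R) (F : coord -> expr) (alpha beta t0 : R)
  (y z : R -> state) :
  analytic_at f (y t0 cn) ->
  solves f F alpha beta y -> solves f F alpha beta z -> alpha < t0 < beta ->
  (forall i, y t0 i = z t0 i) ->
  exists h, 0 < h /\ forall t i, Rabs (t - t0) < h -> y t i = z t i.
Proof.
  intros Hf Hy Hz Ht0 E.
  destruct (coord_uniform (fun i C => 0 < C /\ forall u v,
    (forall j, Rabs (u j - y t0 j) < / C) ->
    (forall j, Rabs (v j - y t0 j) < / C) ->
    Rabs (eval f (F i) u - eval f (F i) v) <= C * dist1 u v)) as [C HC].
  { intros i C D HCD [HC0 H]. split; [lra|]. intros u v Hu Hv.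
    assert (HDC : / D <= / C) by (apply Rinv_le_contravar; lra).
    eapply Rle_trans.
    - apply H; intros j; [specialize (Hu j) | specialize (Hv j)]; lra.
    - apply Rmult_le_compat_r; [apply dist1_pos | exact HCD]. }
  { intros i. destruct (eval_lipschitz f (F i) (y t0) Hf)
      as (L & d & HL & Hd & H).
    assert (Hinv : 0 < / d) by (apply Rinv_0_lt_compat, Hd).
    exists (L + / d). split; [lra|].
    assert (Hle : / (L + / d) <= d).
    { rewrite <- (Rinv_inv d) at 2. apply Rinv_le_contravar; lra. }
    intros u v Hu Hv. eapply Rle_trans.
    - apply H; intros j; [specialize (Hu j) | specialize (Hv j)]; lra.
    - apply Rmult_le_compat_r; [apply dist1_pos | lra]. }
  assert (HC0 : 0 < C) by apply (HC cn).
  assert (Hinv : 0 < / C) by (apply Rinv_0_lt_compat, HC0).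
  destruct (coord_uniform_pos (fun i h => forall t, Rabs (t - t0) < h ->
      alpha < t < beta /\ Rabs (y t i - y t0 i) < / C
      /\ Rabs (z t i - y t0 i) < / C)) as (h & Hh & Hnear).
  { intros i c d [_ Hcd] H t Ht. apply H. lra. }
  { intros i.
    destruct (continuous_eps _ t0 (/ C)
                (solves_continuous _ _ _ _ t0 y Hy Ht0 i) Hinv)
      as (d1 & Hd1 & H1).
    destruct (continuous_eps _ t0 (/ C)
                (solves_continuous _ _ _ _ t0 z Hz Ht0 i) Hinv)
      as (d2 & Hd2 & H2).
    exists (Rmin (Rmin d1 d2) (Rmin (t0 - alpha) (beta - t0))). split.
    - repeat apply Rmin_pos; lra.
    - intros t Ht.
      assert (Hm : Rabs (t - t0) < d1 /\ Rabs (t - t0) < d2 /\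
                   Rabs (t - t0) < t0 - alpha /\ Rabs (t - t0) < beta - t0).
      { repeat split; (eapply Rlt_le_trans; [exact Ht|]).
        - eapply Rle_trans; apply Rmin_l.
        - eapply Rle_trans; [apply Rmin_l | apply Rmin_r].
        - eapply Rle_trans; [apply Rmin_r | apply Rmin_l].
        - eapply Rle_trans; apply Rmin_r. }
      destruct Hm as (Ha & Hb & Hc & Hd).
      apply Rabs_def2 in Hc, Hd. split; [lra|]. split; [apply H1, Ha|].
      rewrite E. apply H2, Hb. }
  set (w := fun i t => y t i - z t i).
  set (w' := fun i t => eval f (F i) (y t) - eval f (F i) (z t)).
  assert (Hw : forall t i, Rabs (t - t0) < h -> is_derive (w i) t (w' i t)).
  { intros t i Ht. destruct (Hnear cn t Ht) as [Hab _].
    apply (is_derive_minus (fun s => y s i) (fun s => z s i));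
      [apply Hy | apply Hz]; exact Hab. }
  assert (Hw' : forall t i, Rabs (t - t0) < h ->
            Rabs (w' i t) <= C * dist1 (y t) (z t)).
  { intros t i Ht. apply HC; intros j; apply (Hnear j t Ht). }
  set (D := fun t => (w cn t) ^ 2 + (w ca t) ^ 2 + (w cA t) ^ 2 + (w cB t) ^ 2).
  set (D' := fun t => 2 * w cn t * w' cn t + 2 * w ca t * w' ca t
                      + 2 * w cA t * w' cA t + 2 * w cB t * w' cB t).
  assert (HD : forall t, Rabs (t - t0) < h -> D t = 0).
  { apply (gronwall_zero D D' (8 * C)).
    - intros t Ht.
      assert (Hsq : forall i, is_derive (fun s => (w i s) ^ 2) t
                                (2 * w i t * w' i t)).
      { intros i. evar_last; [apply is_derive_pow, Hw, Ht|]. simpl. ring. }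
      exact (is_derive_plus _ _ t _ _
               (is_derive_plus _ _ t _ _
                  (is_derive_plus _ _ t _ _ (Hsq cn) (Hsq ca)) (Hsq cA))
               (Hsq cB)).
    - intros t Ht. split.
      { unfold D. pose proof (pow2_ge_0 (w cn t)). pose proof (pow2_ge_0 (w ca t)).
        pose proof (pow2_ge_0 (w cA t)). pose proof (pow2_ge_0 (w cB t)). lra. }
      assert (Hterm : forall i, Rabs (2 * w i t * w' i t)
                <= 2 * C * dist1 (y t) (z t) * Rabs (w i t)).
      { intros i. rewrite !Rabs_mult, (Rabs_pos_eq 2) by lra.
        specialize (Hw' t i Ht). pose proof (Rabs_pos (w i t)). nra. }
      apply Rle_trans with (2 * C * dist1 (y t) (z t) * dist1 (y t) (z t)).
      + unfold D'. eapply Rle_trans; [apply Rabs_triang|].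
        eapply Rle_trans;
          [apply Rplus_le_compat_r; eapply Rle_trans; [apply Rabs_triang|];
           apply Rplus_le_compat_r; apply Rabs_triang|].
        unfold dist1 at 2. fold (w cn t) (w ca t) (w cA t) (w cB t).
        pose proof (Hterm cn). pose proof (Hterm ca).
        pose proof (Hterm cA). pose proof (Hterm cB).
        rewrite !Rmult_plus_distr_l. lra.
      + replace (2 * C * dist1 (y t) (z t) * dist1 (y t) (z t))
          with (2 * C * (dist1 (y t) (z t)) ^ 2) by ring.
        replace (8 * C * D t) with (2 * C * (4 * D t)) by ring.
        apply Rmult_le_compat_l; [lra|].
        unfold D, dist1. fold (w cn t) (w ca t) (w cA t) (w cB t).
        rewrite <- (pow2_abs (w cn t)), <- (pow2_abs (w ca t)),
          <- (pow2_abs (w cA t)), <- (pow2_abs (w cB t)).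
        set (p := Rabs (w cn t)). set (q := Rabs (w ca t)).
        set (r := Rabs (w cA t)). set (s := Rabs (w cB t)).
        pose proof (pow2_ge_0 (p - q)). pose proof (pow2_ge_0 (p - r)).
        pose proof (pow2_ge_0 (p - s)). pose proof (pow2_ge_0 (q - r)).
        pose proof (pow2_ge_0 (q - s)). pose proof (pow2_ge_0 (r - s)). nra.
    - unfold D, w. rewrite !E, !Rminus_diag. ring. }
  exists h. split; [exact Hh|]. intros t i Ht. specialize (HD t Ht).
  unfold D in HD.
  pose proof (pow2_ge_0 (w cn t)). pose proof (pow2_ge_0 (w ca t)).
  pose proof (pow2_ge_0 (w cA t)). pose proof (pow2_ge_0 (w cB t)).
  assert (Hz0 : (w i t) ^ 2 = 0) by (destruct i; lra).
  apply Rminus_diag_uniq. fold (w i t). nra.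
Qed.

Section Maximal.

Variables (f : R -> R) (F : coord -> expr).
Hypothesis (f_analytic : forall x, 0 < x -> analytic_at f x).

Lemma local_solution (y0 : state) (t0 : R) :
  0 < y0 cn ->
  exists h y, 0 < h /\ (forall i, y t0 i = y0 i) /\
    (forall i, analytic_at (fun t => y t i) t0) /\
    solves f F (t0 - h) (t0 + h) y.
Proof.
  intros H0. destruct (local_analytic_solution f F y0 t0 (f_analytic _ H0))
    as (h & y & Hh & E & Han & Hder).
  assert (Hc : continuous (fun s => y s cn) t0)
    by apply analytic_at_continuous, Han.
  destruct (continuous_eps _ t0 (y0 cn) Hc H0) as (d & Hd & Hnear).
  pose proof (Rmin_l h d). pose proof (Rmin_r h d).
  exists (Rmin h d), y. split; [apply Rmin_pos; assumption|].
  split; [exact E|]. split; [exact Han|].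
  intros t Ht. assert (Hlt : Rabs (t - t0) < Rmin h d) by (apply Rabs_def1; lra).
  split.
  - specialize (Hnear t ltac:(lra)). rewrite E in Hnear.
    apply Rabs_def2 in Hnear. lra.
  - apply Hder. lra.
Qed.

Lemma solves_sub (alpha beta alpha' beta' : R) (y : R -> state) :
  alpha <= alpha' -> beta' <= beta ->
  solves f F alpha beta y -> solves f F alpha' beta' y.
Proof. intros Ha Hb Hy t Ht. apply Hy. lra. Qed.

Lemma solution_analytic (alpha beta t0 : R) (y : R -> state) (i : coord) :
  solves f F alpha beta y -> alpha < t0 < beta ->
  analytic_at (fun t => y t i) t0.
Proof.
  intros Hy Ht0. destruct (Hy t0 Ht0) as [Hpos _].
  destruct (local_solution (y t0) t0 Hpos) as (h & z & Hh & E & Han & Hz).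
  destruct (local_uniqueness f F (Rmax alpha (t0 - h)) (Rmin beta (t0 + h)) t0
              z y) as (k & Hk & Heq).
  - rewrite E. apply f_analytic, Hpos.
  - apply (solves_sub (t0 - h) (t0 + h)); [apply Rmax_r | apply Rmin_r | exact Hz].
  - apply (solves_sub alpha beta); [apply Rmax_l | apply Rmin_l | exact Hy].
  - split; [apply Rmax_lub_lt | apply Rmin_glb_lt]; lra.
  - exact E.
  - apply (analytic_at_ext_near (fun t => z t i) _ t0 k Hk); [|apply Han].
    intros t Ht. apply Heq, Ht.
Qed.

Lemma uniqueness (alpha beta t0 : R) (y z : R -> state) :
  solves f F alpha beta y -> solves f F alpha beta z -> alpha < t0 ->
  (forall i, y t0 i = z t0 i) ->
  forall t i, t0 <= t < beta -> y t i = z t i.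
Proof.
  intros Hy Hz Ha E t i Ht.
  enough (H : forall s, t0 <= s <= t -> forall i, y s i = z s i)
    by (apply H; lra).
  clear i.
  apply (real_induction (fun s => forall i, y s i = z s i)).
  - exact E.
  - intros x Hx Hbelow i.
    assert (Hc : continuous (fun s => y s i - z s i) x).
    { apply (continuous_minus (fun s => y s i) (fun s => z s i));
        eapply solves_continuous; eassumption || lra. }
    apply Rminus_diag_uniq, Rabs_eq_0, Rle_antisym; [|apply Rabs_pos].
    apply Rnot_lt_le. intros Hlt.
    destruct (continuous_eps _ x _ Hc Hlt) as (d & Hd & Hnear).
    set (s := Rmax t0 (x - d / 2)).
    assert (Hs : t0 <= s < x /\ x - d / 2 <= s).
    { unfold s, Rmax. destruct (Rle_dec _ _); lra. }
    specialize (Hnear s ltac:(apply Rabs_def1; lra)).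
    rewrite (Hbelow s ltac:(lra) i), Rminus_diag, Rminus_0_l, Rabs_Ropp in Hnear.
    lra.
  - intros x Hx Ex.
    destruct (local_uniqueness f F alpha beta x y z) as (d & Hd & Hnear);
      try assumption; try lra.
    + apply f_analytic, (Hy x). lra.
    + exists d. split; [exact Hd|]. intros s Hs i. apply Hnear.
      apply Rabs_def1; lra.
Qed.

Lemma eval_bounded (e : expr) (m M : R) :
  0 < m ->
  exists C, forall u : state, m <= u cn -> (forall i, Rabs (u i) <= M) ->
    Rabs (eval f e u) <= C.
Proof.
  intros Hm. induction e as [r|i|e1 [C1 IH1] e2 [C2 IH2]|e1 [C1 IH1] e2 [C2 IH2]|];
    simpl.
  - exists (Rabs r). intros. lra.
  - exists M. auto.
  - exists (C1 + C2). intros u Hu HM. eapply Rle_trans; [apply Rabs_triang|].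
    specialize (IH1 u Hu HM). specialize (IH2 u Hu HM). lra.
  - exists (C1 * C2). intros u Hu HM. rewrite Rabs_mult.
    apply Rmult_le_compat; auto using Rabs_pos.
  - destruct (Rle_dec m M) as [HmM|HmM].
    + destruct (continuity_ab_maj (fun x => Rabs (f x)) m M HmM) as (x & Hx & _).
      { intros x Hx. apply continuity_pt_filterlim.
        apply (continuous_comp f Rabs).
        - apply analytic_at_continuous, f_analytic. lra.
        - apply continuous_Rabs. }
      exists (Rabs (f x)). intros u Hu HM. apply Hx.
      specialize (HM cn). pose proof (Rle_abs (u cn)). lra.
    + exists 0. intros u Hu HM. specialize (HM cn).
      pose proof (Rle_abs (u cn)). lra.
Qed.

(** In a compact part of the half-space [n > 0] the right-hand side is bounded,
    so the solution has a limit at [beta], and the solution starting from this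
    limit continues it. *)
Lemma continuation (alpha t1 beta m M : R) (y : R -> state) :
  alpha <= t1 < beta -> solves f F alpha beta y -> 0 < m ->
  (forall t, t1 < t < beta -> m <= y t cn /\ forall i, Rabs (y t i) <= M) ->
  exists h z, 0 < h /\ (forall t, t < beta -> z t = y t) /\
    solves f F alpha (beta + h) z.
Proof.
  intros Ht1 Hy Hm Hbox.
  assert (Hlim : forall i, exists l,
            filterlim (fun t => y t i) (at_left beta) (locally l)).
  { intros i. destruct (eval_bounded (F i) m M Hm) as [C HC].
    apply (left_limit_of_lipschitz _ t1 beta C); [lra|]. intros s t Hs Ht.
    apply (lipschitz_of_derive (fun t => y t i)
             (fun t => eval f (F i) (y t)) t1 beta); try assumption.
    - intros x Hx. apply (Hy x). lra.
    - intros x Hx. destruct (Hbox x Hx). apply HC; assumption. }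
  set (l := fun i => proj1_sig (constructive_indefinite_description _ (Hlim i))).
  assert (Hl : forall i, filterlim (fun t => y t i) (at_left beta) (locally (l i))).
  { intros i. unfold l. apply proj2_sig. }
  assert (Hl0 : 0 < l cn).
  { apply Rlt_le_trans with m; [exact Hm|]. apply Rnot_lt_le. intros Hlt.
    destruct (filterlim_at_left_eps _ _ _ (m - l cn) (Hl cn) ltac:(lra))
      as (d & Hd & Hnear).
    set (t := Rmax (beta - d / 2) ((t1 + beta) / 2)).
    assert (Ht : t1 < t < beta /\ beta - d < t).
    { unfold t, Rmax. destruct (Rle_dec _ _); lra. }
    specialize (Hnear t ltac:(lra)). apply Rabs_def2 in Hnear.
    destruct (Hbox t ltac:(lra)). lra. }
  destruct (local_solution l beta Hl0) as (h & w & Hh & E & _ & Hw).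
  set (z := fun t => if Rlt_dec t beta then y t else w t).
  assert (Hzl : forall t, t < beta -> z t = y t).
  { intros t Ht. unfold z. destruct (Rlt_dec t beta); [reflexivity|lra]. }
  assert (Hzr : forall t, beta <= t -> z t = w t).
  { intros t Ht. unfold z. destruct (Rlt_dec t beta); [lra|reflexivity]. }
  assert (Hleft : forall t, alpha < t < beta -> 0 < z t cn /\
            forall i, is_derive (fun s => z s i) t (eval f (F i) (z t))).
  { intros t Ht. rewrite Hzl by lra. destruct (Hy t Ht) as [Hp Hd].
    split; [exact Hp|]. intros i.
    apply (is_derive_ext_near (fun s => y s i) _ t _ (beta - t)); [lra| |apply Hd].
    intros s Hs. apply Rabs_def2 in Hs. rewrite Hzl by lra. reflexivity. }
  assert (Hright : forall t, beta < t < beta + h -> 0 < z t cn /\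
            forall i, is_derive (fun s => z s i) t (eval f (F i) (z t))).
  { intros t Ht. rewrite Hzr by lra. destruct (Hw t ltac:(lra)) as [Hp Hd].
    split; [exact Hp|]. intros i.
    apply (is_derive_ext_near (fun s => w s i) _ t _ (t - beta)); [lra| |apply Hd].
    intros s Hs. apply Rabs_def2 in Hs. rewrite Hzr by lra. reflexivity. }
  assert (Hzc : forall i, continuous (fun s => z s i) beta).
  { intros i. apply eps_continuous. intros eps Heps.
    destruct (filterlim_at_left_eps _ _ _ eps (Hl i) Heps) as (d1 & Hd1 & H1).
    destruct (continuous_eps (fun s => w s i) beta eps) as (d2 & Hd2 & H2).
    { apply (solves_continuous f F (beta - h) (beta + h)); [exact Hw|lra]. }
    { exact Heps. }
    exists (Rmin d1 d2). split; [apply Rmin_pos; assumption|]. intros t Ht.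
    pose proof (Rmin_l d1 d2). pose proof (Rmin_r d1 d2).
    rewrite (Hzr beta) by lra. destruct (Rlt_dec t beta) as [Hlt|Hge].
    - rewrite Hzl, E by exact Hlt. apply H1. apply Rabs_def2 in Ht. lra.
    - rewrite Hzr by lra. apply H2. lra. }
  assert (Hzb : 0 < z beta cn) by (rewrite Hzr, E by lra; exact Hl0).
  exists h, z. split; [exact Hh|]. split; [exact Hzl|].
  intros t Ht. destruct (Rtotal_order t beta) as [Hlt|[->|Hgt]].
  - apply Hleft. lra.
  - split; [exact Hzb|]. intros i.
    apply (is_derive_at_limit (fun s => z s i) (fun s => eval f (F i) (z s)) beta
             (Rmin h (beta - alpha))).
    + apply Rmin_pos; lra.
    + apply Hzc.
    + apply eval_continuous; [apply f_analytic, Hzb | exact Hzc].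
    + intros t Hne Hnear.
      pose proof (Rmin_l h (beta - alpha)). pose proof (Rmin_r h (beta - alpha)).
      apply Rabs_def2 in Hnear.
      destruct (Rlt_dec t beta); [apply Hleft | apply Hright]; lra.
  - apply Hright. lra.
Qed.

(** The union of all solutions with the given initial state, which is
    consistent by uniqueness.  If it left [T] finite while staying in a compact
    set, continuation would contradict the choice of [T] as a supremum. *)
Lemma maximal_solution (y0 : state) :
  0 < y0 cn ->
  exists (T : Rbar) (h : R) (y : R -> state),
    Rbar_lt 0 T /\ 0 < h /\ (forall i, y 0 i = y0 i) /\
    (forall beta : R, Rbar_le beta T -> solves f F (- h) beta y) /\
    forall T' m M : R, T = T' -> 0 < m ->
      exists t, 0 <= t < T' /\
        ~ (m <= y t cn /\ forall i, Rabs (y t i) <= M).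
Proof.
  intros H0. destruct (local_solution y0 0 H0) as (h & w & Hh & Ew & _ & Hw).
  rewrite Rminus_0_l, Rplus_0_l in Hw.
  set (is_sol := fun beta y => (forall i, y 0 i = y0 i) /\ solves f F (- h) beta y).
  set (S := fun beta => exists y, is_sol beta y).
  destruct (Lub_Rbar_correct S) as [Hub Hlub]. set (T := Lub_Rbar S) in *.
  assert (HhT : Rbar_le h T) by (apply Hub; exists w; split; assumption).
  assert (Hbefore : forall t : R, Rbar_lt t T -> exists b, S b /\ t < b).
  { intros t Ht. apply NNPP. intros Hno. apply (Rbar_lt_not_le _ _ Ht).
    apply Hlub. intros b Hb. simpl. apply Rnot_lt_le. intros Hlt.
    apply Hno. exists b. split; assumption. }
  assert (Hchoice : forall t : R, exists y, Rbar_lt t T ->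
            exists b, t < b /\ is_sol b y).
  { intros t. destruct (classic (Rbar_lt t T)) as [Ht|Ht].
    - destruct (Hbefore t Ht) as (b & [y Hy] & Hb). exists y. intros _.
      exists b. split; assumption.
    - exists w. intros Ht'. contradiction. }
  set (pick := fun t => proj1_sig
                 (constructive_indefinite_description _ (Hchoice t))).
  assert (Hpick : forall t : R, Rbar_lt t T -> exists b, t < b /\ is_sol b (pick t)).
  { intros t Ht. unfold pick.
    destruct (constructive_indefinite_description _ (Hchoice t)) as [y Hy].
    exact (Hy Ht). }
  set (y := fun t => if Rle_dec 0 t then pick t t else w t).
  assert (Hagree : forall b z t i, is_sol b z -> 0 <= t < b -> y t i = z t i).
  { intros b z t i Hz Ht. unfold y. destruct (Rle_dec 0 t) as [_|]; [|lra].
    destruct (Hpick t) as (b' & Hb' & [E' Hs']).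
    { apply Rbar_lt_le_trans with b; [simpl; lra|]. apply Hub.
      exists z. exact Hz. }
    destruct Hz as [Ez Hz].
    apply (uniqueness (- h) (Rmin b b') 0).
    - apply (solves_sub (- h) b'); [lra | apply Rmin_r | exact Hs'].
    - apply (solves_sub (- h) b); [lra | apply Rmin_l | exact Hz].
    - lra.
    - intros j. rewrite E', Ez. reflexivity.
    - split; [lra|]. apply Rmin_glb_lt; lra. }
  assert (Hyw : forall t i, t < h -> y t i = w t i).
  { intros t i Ht. destruct (Rle_dec 0 t) as [Hp|Hn].
    - apply (Hagree h); [split; assumption | lra].
    - unfold y. destruct (Rle_dec 0 t); [contradiction|reflexivity]. }
  assert (Hsol : forall beta : R, Rbar_le beta T -> solves f F (- h) beta y).
  { intros beta Hbeta t Ht.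
    assert (Hnear : exists d z, 0 < d /\
              (forall s i, Rabs (s - t) < d -> y s i = z s i) /\ 0 < z t cn /\
              forall i, is_derive (fun s => z s i) t (eval f (F i) (z t))).
    { destruct (Rlt_dec t h) as [Hth|Hth].
      - exists (h - t), w. split; [lra|]. split; [|apply Hw; lra].
        intros s i Hs. apply Rabs_def2 in Hs. apply Hyw. lra.
      - destruct (Hbefore t) as (b & [z Hz] & Hb).
        { apply Rbar_lt_le_trans with beta; [simpl; lra | exact Hbeta]. }
        exists (Rmin t (b - t)), z. split; [apply Rmin_pos; lra|]. split.
        + intros s i Hs. pose proof (Rmin_l t (b - t)).
          pose proof (Rmin_r t (b - t)). apply Rabs_def2 in Hs.
          apply (Hagree b); [exact Hz | lra].
        + apply Hz. lra. }
    destruct Hnear as (d & z & Hd & E & Hpos & Hder).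
    assert (Et : forall i, z t i = y t i).
    { intros i. symmetry. apply E. rewrite Rminus_diag, Rabs_R0. exact Hd. }
    split; [rewrite <- Et; exact Hpos|]. intros i.
    apply (is_derive_ext_near (fun s => z s i) _ t _ d Hd).
    { intros s Hs. symmetry. apply E, Hs. }
    replace (eval f (F i) (y t)) with (eval f (F i) (z t)); [apply Hder|].
    assert (Hext : forall e, eval f e (z t) = eval f e (y t)).
    { induction e as [r|j|e1 IH1 e2 IH2|e1 IH1 e2 IH2|]; simpl; congruence. }
    apply Hext. }
  assert (Hy0 : forall i, y 0 i = y0 i).
  { intros i. rewrite Hyw by exact Hh. apply Ew. }
  exists T, h, y. split; [|split; [exact Hh|split; [exact Hy0|split; [exact Hsol|]]]].
  - apply Rbar_lt_le_trans with h; [exact Hh | exact HhT].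
  - intros T' m M ET Hm. apply NNPP. intros Hno. rewrite ET in *.
    simpl in HhT.
    destruct (continuation (- h) 0 T' m M y) as (k & z & Hk & Ez & Hz).
    + lra.
    + apply Hsol. apply Rbar_le_refl.
    + exact Hm.
    + intros t Ht. apply NNPP. intros Hout. apply Hno. exists t.
      split; [lra | exact Hout].
    + assert (HT : Rbar_le (T' + k) T').
      { apply Hub. exists z. split; [|exact Hz].
        intros i. rewrite Ez by lra. apply Hy0. }
      simpl in HT. lra.
Qed.

End Maximal.

(** * A priori estimates *)

Lemma in_time_le (T : Rbar) (s t : R) : in_time T t -> 0 <= s <= t -> in_time T s.
Proof.
  intros [_ Ht] Hs. split; [lra|].
  apply Rbar_le_lt_trans with t; [simpl; lra | exact Ht].
Qed.

Section Damping.

Variables (f : R -> R) (eps eta0 : R).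
Hypothesis (f_analytic : forall eta, 0 < eta -> analytic_at f eta).
Hypothesis (f_nonneg : forall eta, 0 < eta -> 0 <= f eta).
Hypothesis (eps_pos : 0 < eps) (eta0_pos : 0 < eta0).

Definition damping_integral (x : R) : R := RInt (fun eta => f eta / eta ^ 2) eta0 x.

Lemma damping_integral_derive (x : R) :
  0 < x -> is_derive damping_integral x (f x / x ^ 2).
Proof.
  intros Hx.
  assert (Hc : forall z, 0 < z -> continuous (fun eta => f eta / eta ^ 2) z).
  { intros z Hz. apply (continuous_mult f (fun eta => / eta ^ 2)).
    - apply analytic_at_continuous, f_analytic, Hz.
    - apply (is_derive_continuous _ z (- 2 / z ^ 3)).
      auto_derive; [nra | field; lra]. }
  apply (is_derive_RInt (fun eta => f eta / eta ^ 2) damping_integral eta0);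
    [|apply Hc, Hx].
  exists (mkposreal x Hx). intros y Hy.
  change (Rabs (y - x) < x) in Hy. apply Rabs_def2 in Hy.
  apply (RInt_correct (V := R_CompleteNormedModule)), ex_RInt_continuous.
  intros z Hz. apply Hc. revert Hz. unfold Rmin, Rmax.
  destruct (Rle_dec eta0 y); lra.
Qed.

Lemma damping_integral_incr (x y : R) :
  0 < x <= y -> damping_integral x <= damping_integral y.
Proof.
  intros Hxy.
  apply (increasing_of_derive damping_integral (fun z => f z / z ^ 2)).
  - lra.
  - intros z Hz. apply damping_integral_derive. lra.
  - intros z Hz. apply Rdiv_le_0_compat; [apply f_nonneg; lra | nra].
Qed.

Lemma damping_integral_unbounded :
  improper_integral_diverges (fun eta => f eta / eta ^ 2) eta0 ->
  forall M, exists N, 0 < N /\ forall x, N < x -> M < damping_integral x.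
Proof.
  intros Hdiv M. apply is_lim_spec in Hdiv. destruct (Hdiv M) as [N HN].
  exists (Rmax N 1). split; [apply Rlt_le_trans with 1; [lra | apply Rmax_r]|].
  intros x Hx. apply HN. eapply Rle_lt_trans; [apply Rmax_l | exact Hx].
Qed.

(** A monotone function without limit [+oo] is bounded above. *)
Lemma damping_integral_bounded :
  ~ improper_integral_diverges (fun eta => f eta / eta ^ 2) eta0 ->
  exists K, forall x, 0 < x -> damping_integral x <= K.
Proof.
  intros Hconv. apply NNPP. intros Hno. apply Hconv, is_lim_spec. intros M.
  destruct (classic (exists x, 0 < x /\ M < damping_integral x))
    as [(N & HN & HM)|H].
  - exists N. intros x Hx. eapply Rlt_le_trans; [exact HM|].
    apply damping_integral_incr. lra.
  - exfalso. apply Hno. exists M. intros x Hx. apply Rnot_lt_le. intros Hlt.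
    apply H. exists x. split; assumption.
Qed.

(** The gradient part of the system: [n] is the density and [a] is [V_x]. *)
Definition gradient_solution (T : Rbar) (n a : R -> R) : Prop :=
  forall t, in_time T t ->
    0 < n t /\ is_derive n t (- (a t * n t)) /\
    is_derive a t (- (a t) ^ 2 + n t - 1 - eps * f (n t) * a t).

Section Gradient.

Variables (T : Rbar) (n a : R -> R).
Hypothesis (sol : gradient_solution T n a).

(** [s = 1 / n] satisfies [s' = p] and
    [p' = 1 - s - nu p]: a damped harmonic oscillator around [s = 1]. *)
Let s (t : R) : R := / n t.
Let p (t : R) : R := a t / n t.

Lemma s_pos (t : R) : in_time T t -> 0 < s t.
Proof. intros Ht. apply Rinv_0_lt_compat, (sol t Ht). Qed.

Lemma a_eq (t : R) : in_time T t -> a t = p t * n t.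
Proof. intros Ht. destruct (sol t Ht) as [Hn _]. unfold p. field. lra. Qed.

Lemma s_derive (t : R) : in_time T t -> is_derive s t (p t).
Proof.
  intros Ht. destruct (sol t Ht) as (Hn & Hdn & _).
  evar_last; [apply is_derive_inv; [exact Hdn | lra]|].
  unfold p. field. lra.
Qed.

Lemma p_derive (t : R) :
  in_time T t -> is_derive p t (1 - s t - eps * f (n t) * p t).
Proof.
  intros Ht. destruct (sol t Ht) as (Hn & Hdn & Hda).
  evar_last; [apply is_derive_div; [exact Hda | exact Hdn | lra]|].
  unfold p, s. field. lra.
Qed.

Lemma energy_decr (t : R) :
  in_time T t ->
  (p t) ^ 2 + (s t - 1) ^ 2 <= (p 0) ^ 2 + (s 0 - 1) ^ 2.
Proof.
  intros Ht.
  apply (decreasing_of_derive (fun x => (p x) ^ 2 + (s x - 1) ^ 2)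
           (fun x => - 2 * (eps * f (n x)) * (p x) ^ 2) 0 t).
  - apply Ht.
  - intros x Hx. pose proof (in_time_le T x t Ht Hx) as HxT.
    evar_last.
    + apply (is_derive_plus (fun x => (p x) ^ 2) (fun x => (s x - 1) ^ 2)).
      * apply is_derive_pow, p_derive, HxT.
      * apply is_derive_pow.
        apply (is_derive_minus s (fun _ => 1) x (p x) 0);
          [apply s_derive, HxT | exact (is_derive_const 1 x)].
    + unfold plus, minus, opp; simpl. unfold plus, opp; simpl. ring.
  - intros x Hx. destruct (sol x (in_time_le T x t Ht ltac:(lra))) as [Hn _].
    pose proof (f_nonneg _ Hn). pose proof (pow2_ge_0 (p x)).
    assert (0 <= eps * f (n x)) by (apply Rmult_le_pos; lra). nra.
Qed.

Lemma oscillator_bounded :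
  exists C, 0 < C /\ forall t, in_time T t -> Rabs (p t) <= C /\ s t <= C.
Proof.
  exists ((p 0) ^ 2 + (s 0 - 1) ^ 2 + 2).
  pose proof (pow2_ge_0 (p 0)). pose proof (pow2_ge_0 (s 0 - 1)).
  split; [lra|]. intros t Ht. pose proof (energy_decr t Ht) as He.
  pose proof (pow2_ge_0 (p t)). pose proof (pow2_ge_0 (s t - 1)).
  split.
  - rewrite <- (pow2_abs (p t)) in He. pose proof (Rabs_pos (p t)). nra.
  - nra.
Qed.

(** The damping drops out of the derivative of this combination, because
    [nu(n) p] is itself the derivative of [eps * damping_integral n] up to
    sign. *)
Let q (t : R) : R := p t - eps * damping_integral (n t).

Lemma q_derive (t : R) : in_time T t -> is_derive q t (1 - s t).
Proof.
  intros Ht. destruct (sol t Ht) as (Hn & Hdn & _).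
  evar_last.
  - apply (is_derive_minus p (fun t => eps * damping_integral (n t))).
    + apply p_derive, Ht.
    + apply (is_derive_scal (fun t => damping_integral (n t))).
      apply (is_derive_comp damping_integral n);
        [apply damping_integral_derive, Hn | exact Hdn].
  - unfold minus, plus, opp, scal; simpl. unfold mult; simpl.
    unfold p. field. lra.
Qed.

(** After the last time at which [n <= c], where [c >= 1], one has [s <= 1] and
    [q] increases; so the damping integral of [n] stays within a fixed distance
    of its value at [c]. *)
Lemma density_bounded :
  improper_integral_diverges (fun eta => f eta / eta ^ 2) eta0 ->
  exists N, forall t, in_time T t -> n t <= N.
Proof.
  intros Hdiv. destruct oscillator_bounded as (C & HC & Hosc).
  set (c := Rmax (n 0) 1).
  assert (Hc1 : 1 <= c) by apply Rmax_r.
  destruct (damping_integral_unbounded Hdiv ((2 * C) / eps + damping_integral c))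
    as (N & HN & Hbig).
  exists (Rmax N c). intros t Ht. apply Rnot_lt_le. intros Hlt.
  assert (HNt : N < n t) by (eapply Rle_lt_trans; [apply Rmax_l | exact Hlt]).
  assert (Hct : c < n t) by (eapply Rle_lt_trans; [apply Rmax_r | exact Hlt]).
  destruct (last_below n 0 t c) as (t1 & Ht1 & Hn1 & Hafter).
  - apply Ht.
  - intros x Hx. eapply is_derive_continuous.
    apply (sol x (in_time_le T x t Ht Hx)).
  - apply Rmax_l.
  - exact Hct.
  - assert (HT1 : in_time T t1) by (apply (in_time_le T t1 t Ht); lra).
    assert (Hq : q t1 <= q t).
    { apply (increasing_of_derive q (fun x => 1 - s x)).
      - lra.
      - intros x Hx. apply q_derive, (in_time_le T x t Ht). lra.
      - intros x Hx. specialize (Hafter x ltac:(lra)).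
        enough (s x <= 1) by lra. unfold s. rewrite <- Rinv_1.
        apply Rinv_le_contravar; lra. }
    unfold q in Hq. destruct (Hosc t Ht) as [Hp _].
    destruct (Hosc t1 HT1) as [Hp1 _].
    pose proof (Rle_abs (p t)). pose proof (Rle_abs (- p t1)) as Hp1'.
    rewrite Rabs_Ropp in Hp1'.
    pose proof (damping_integral_incr (n t1) c (conj (proj1 (sol t1 HT1)) Hn1)).
    specialize (Hbig (n t) HNt).
    assert (Hmul : eps * (2 * C / eps + damping_integral c)
                   < eps * damping_integral (n t))
      by (apply Rmult_lt_compat_l; assumption).
    rewrite Rmult_plus_distr_l in Hmul.
    replace (eps * (2 * C / eps)) with (2 * C) in Hmul by (field; lra). nra.
Qed.

Lemma gradient_bounded_of_density (N : R) :
  (forall t, in_time T t -> n t <= N) ->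
  exists m M, 0 < m /\
    forall t, in_time T t -> m <= n t /\ Rabs (n t) <= M /\ Rabs (a t) <= M.
Proof.
  intros HN. destruct oscillator_bounded as (C & HC & Hosc).
  exists (/ C), ((C + 1) * Rabs N). split; [apply Rinv_0_lt_compat, HC|].
  intros t Ht. destruct (sol t Ht) as [Hn _]. destruct (Hosc t Ht) as [Hp Hs].
  specialize (HN t Ht). pose proof (Rle_abs N).
  split; [|split].
  - rewrite <- (Rinv_inv (n t)). apply Rinv_le_contravar; [|exact Hs].
    apply s_pos, Ht.
  - rewrite Rabs_pos_eq by lra. nra.
  - rewrite (a_eq t Ht), Rabs_mult, (Rabs_pos_eq (n t)) by lra.
    apply Rle_trans with (C * Rabs N); [|nra].
    apply Rmult_le_compat; try lra. apply Rabs_pos.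
Qed.

Lemma gradient_bounded :
  improper_integral_diverges (fun eta => f eta / eta ^ 2) eta0 ->
  exists m M, 0 < m /\
    forall t, in_time T t -> m <= n t /\ Rabs (n t) <= M /\ Rabs (a t) <= M.
Proof.
  intros Hdiv. destruct (density_bounded Hdiv) as [N HN].
  exact (gradient_bounded_of_density N HN).
Qed.

(** With the damping integral bounded by [K], an initial velocity gradient
    of [- (3 + eps (K - damping_integral 1))] at density 1 is not stopped by the
    damping: [q' <= 1] keeps [p <= -2] up to time 1. *)
Lemma inverse_density_falls (K t : R) :
  (forall x, 0 < x -> damping_integral x <= K) ->
  n 0 = 1 -> a 0 = - (3 + eps * (K - damping_integral 1)) ->
  in_time T t -> t <= 1 -> p t <= - 2.
Proof.
  intros HK Hn0 Ha0 Ht Ht1.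
  assert (Hq : q t - t <= q 0 - 0).
  { apply (decreasing_of_derive (fun x => q x - x) (fun x => 1 - s x - 1)).
    - apply Ht.
    - intros x Hx.
      apply (is_derive_minus q (fun x => x)); [|exact (is_derive_id x)].
      apply q_derive, (in_time_le T x t Ht Hx).
    - intros x Hx.
      pose proof (s_pos x (in_time_le T x t Ht ltac:(lra))). lra. }
  unfold q in Hq. unfold p at 2 in Hq. rewrite Hn0, Ha0 in Hq.
  pose proof (HK (n t) (proj1 (sol t Ht))) as HKt.
  assert (eps * damping_integral (n t) <= eps * K)
    by (apply Rmult_le_compat_l; lra).
  rewrite Rmult_minus_distr_l in Hq. lra.
Qed.

(** [s] starts at 1, decreases at least at the rate 2, and stays positive. *)
Lemma lifespan_le_three_quarters (K : R) :
  (forall x, 0 < x -> damping_integral x <= K) ->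
  n 0 = 1 -> a 0 = - (3 + eps * (K - damping_integral 1)) ->
  ~ Rbar_lt (3 / 4) T.
Proof.
  intros HK Hn0 Ha0 HT.
  assert (Ht : in_time T (3 / 4)) by (split; [lra | exact HT]).
  assert (H : s (3 / 4) + 2 * (3 / 4) <= s 0 + 2 * 0).
  { apply (decreasing_of_derive (fun x => s x + 2 * x) (fun x => p x + 2)).
    - lra.
    - intros x Hx. apply (is_derive_plus s (fun x => 2 * x)).
      + apply s_derive, (in_time_le T x _ Ht Hx).
      + auto_derive; [exact I | ring].
    - intros x Hx.
      pose proof (inverse_density_falls K x HK Hn0 Ha0
                    (in_time_le T x _ Ht ltac:(lra)) ltac:(lra)). lra. }
  unfold s at 2 in H. rewrite Hn0, Rinv_1 in H. pose proof (s_pos _ Ht). lra.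
Qed.

Lemma density_incr_gradient_le (K x t : R) :
  (forall x, 0 < x -> damping_integral x <= K) ->
  n 0 = 1 -> a 0 = - (3 + eps * (K - damping_integral 1)) ->
  0 <= x <= t -> in_time T t -> t <= 1 ->
  n x <= n t /\ a t <= - 2 * n t.
Proof.
  intros HK Hn0 Ha0 Hx Ht Ht1. split.
  - apply (increasing_of_derive n (fun y => - (a y * n y))).
    + lra.
    + intros y Hy. apply (sol y), (in_time_le T y t Ht). lra.
    + intros y Hy.
      assert (Hty : in_time T y) by (apply (in_time_le T y t Ht); lra).
      pose proof (inverse_density_falls K y HK Hn0 Ha0 Hty ltac:(lra)).
      rewrite (a_eq y Hty). destruct (sol y Hty) as [Hn _].
      assert (0 < n y * n y) by (apply Rmult_lt_0_compat; exact Hn). nra.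
  - pose proof (inverse_density_falls K t HK Hn0 Ha0 Ht Ht1).
    rewrite (a_eq t Ht). destruct (sol t Ht) as [Hn _]. nra.
Qed.

(** [A] and [B] solve a linear system, and the damping only helps. *)
Lemma offset_bounded (A B : R -> R) (T' K : R) :
  Rbar_le T T' ->
  (forall t, in_time T t -> n t <= K /\ Rabs (a t) <= K) ->
  (forall t, in_time T t ->
     is_derive A t (- (a t * A t) - B t - eps * f (n t) * A t) /\
     is_derive B t (A t * n t)) ->
  exists M, forall t, in_time T t -> Rabs (A t) <= M /\ Rabs (B t) <= M.
Proof.
  intros HT HK HAB.
  set (L := 3 * K + 1). set (D := fun t => (A t) ^ 2 + (B t) ^ 2).
  exists (D 0 * exp (Rabs L * Rabs T') + 1). intros t Ht.
  assert (Hdecr : D t * exp (- L * t) <= D 0 * exp (- L * 0)).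
  { apply (decreasing_of_derive (fun x => D x * exp (- L * x))
      (fun x => ((2 * A x * (- (a x * A x) - B x - eps * f (n x) * A x)
                  + 2 * B x * (A x * n x)) - L * D x) * exp (- L * x))).
    - apply Ht.
    - intros x Hx. pose proof (in_time_le T x t Ht Hx) as HxT.
      destruct (HAB x HxT) as [HA HB].
      assert (HD : is_derive D x
                (2 * A x * (- (a x * A x) - B x - eps * f (n x) * A x)
                 + 2 * B x * (A x * n x))).
      { evar_last.
        - apply (is_derive_plus (fun x => (A x) ^ 2) (fun x => (B x) ^ 2));
            apply is_derive_pow; eassumption.
        - unfold plus; simpl. ring. }
      assert (HE : is_derive (fun x => exp (- L * x)) x (- L * exp (- L * x)))
        by (auto_derive; [exact I | ring]).
      evar_last; [apply (is_derive_mult D _ x _ _ HD HE Rmult_comm)|].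
      unfold plus, mult; simpl. ring.
    - intros x Hx. pose proof (in_time_le T x t Ht ltac:(lra)) as HxT.
      destruct (HK x HxT) as [Hn Ha]. destruct (sol x HxT) as [Hn0 _].
      pose proof (Rle_abs (- a x)) as Ha'. rewrite Rabs_Ropp in Ha'.
      pose proof (f_nonneg _ Hn0).
      assert (0 <= eps * f (n x)) by (apply Rmult_le_pos; lra).
      pose proof (exp_pos (- L * x)).
      enough (2 * A x * (- (a x * A x) - B x - eps * f (n x) * A x)
                  + 2 * B x * (A x * n x) - L * D x <= 0) by nra.
      unfold L, D.
      pose proof (pow2_ge_0 (A x)). pose proof (pow2_ge_0 (B x)).
      pose proof (pow2_ge_0 (A x + B x)). pose proof (pow2_ge_0 (A x - B x)).
      assert (0 <= (K + a x) * (A x) ^ 2) by (apply Rmult_le_pos; lra).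
      assert (0 <= eps * f (n x) * (A x) ^ 2) by (apply Rmult_le_pos; lra).
      assert (0 <= n x * (A x - B x) ^ 2) by (apply Rmult_le_pos; lra).
      assert (0 <= (K - n x) * ((A x) ^ 2 + (B x) ^ 2))
        by (apply Rmult_le_pos; lra).
      assert (0 <= K * (B x) ^ 2) by (apply Rmult_le_pos; lra).
      nra. }
  rewrite Rmult_0_r, exp_0, Rmult_1_r in Hdecr.
  assert (HtT : Rabs t <= Rabs T').
  { destruct Ht as [H0 Ht]. assert (Hlt : Rbar_lt t T')
      by (eapply Rbar_lt_le_trans; eassumption).
    simpl in Hlt. rewrite !Rabs_pos_eq; lra. }
  assert (HDpos : forall x, 0 <= D x).
  { intros x. unfold D. pose proof (pow2_ge_0 (A x)).
    pose proof (pow2_ge_0 (B x)). lra. }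
  assert (HDt : D t <= D 0 * exp (Rabs L * Rabs T')).
  { apply Rle_trans with (D 0 * exp (L * t)).
    - replace (D t) with (D t * exp (- L * t) * exp (L * t)).
      + apply Rmult_le_compat_r; [apply Rlt_le, exp_pos | exact Hdecr].
      + rewrite Rmult_assoc, <- exp_plus.
        replace (- L * t + L * t) with 0 by ring. rewrite exp_0. ring.
    - apply Rmult_le_compat_l; [apply HDpos|].
      assert (Hle : L * t <= Rabs L * Rabs T').
      { eapply Rle_trans; [apply Rle_abs|]. rewrite Rabs_mult.
        apply Rmult_le_compat_l; [apply Rabs_pos | exact HtT]. }
      destruct Hle as [Hlt| ->]; [apply Rlt_le, exp_increasing, Hlt | lra]. }
  unfold D in HDt at 1.
  rewrite <- (pow2_abs (A t)), <- (pow2_abs (B t)) in HDt.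
  pose proof (pow2_ge_0 (Rabs (A t))). pose proof (pow2_ge_0 (Rabs (B t))).
  pose proof (Rabs_pos (A t)). pose proof (Rabs_pos (B t)).
  split; nra.
Qed.

End Gradient.

End Damping.

(** * One-sided time derivatives *)

Lemma is_derive_is_time_derive (g : R -> R) (t l : R) :
  0 <= t -> is_derive g t l -> is_time_derive g t l.
Proof.
  intros Ht Hg.
  assert (HF : ProperFilter (within (fun s => 0 <= s) (locally t))).
  { constructor; [|apply within_filter, locally_filter].
    intros P HP. exists t. apply (locally_singleton _ _ HP), Ht. }
  apply (filterdiff_locally (U := R_NormedModule) g t); [|exact Hg].
  intros P HP. unfold within. apply filter_imp with P; auto.
Qed.

Lemma is_time_derive_eps (g : R -> R) (t l eps : R) :
  is_time_derive g t l -> 0 < eps ->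
  exists d, 0 < d /\ forall s, 0 <= s -> Rabs (s - t) < d ->
    Rabs (g s - g t - (s - t) * l) <= eps * Rabs (s - t).
Proof.
  intros [_ Hg] Heps.
  assert (Hlim : is_filter_lim (within (fun s => 0 <= s) (locally t)) t).
  { intros P HP. unfold within. apply filter_imp with P; auto. }
  destruct (Hg t Hlim (mkposreal eps Heps)) as [[d Hd] H].
  exists d. split; [exact Hd|]. intros s Hs Hst. exact (H s Hst Hs).
Qed.

(** Continuing a function on [0, +oo) by its tangent at 0 turns its derivatives
    relative to the half-line into two-sided ones. *)
Definition tangent_extension (g : R -> R) (l0 t : R) : R :=
  if Rle_dec 0 t then g t else g 0 + t * l0.

Lemma tangent_extension_eq (g : R -> R) (l0 t : R) :
  0 <= t -> tangent_extension g l0 t = g t.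
Proof.
  intros Ht. unfold tangent_extension.
  destruct (Rle_dec 0 t); [reflexivity|contradiction].
Qed.

Lemma tangent_extension_derive (g : R -> R) (l0 t l : R) :
  0 <= t -> (t = 0 -> l = l0) -> is_time_derive g t l ->
  is_derive (tangent_extension g l0) t l.
Proof.
  intros Ht Hl Hg. split; [exact (is_linear_scal_l l)|].
  intros x Hx [eps Heps].
  rewrite <- (is_filter_lim_locally_unique (K := R_AbsRing)
                (V := R_NormedModule) _ _ Hx).
  destruct (is_time_derive_eps g t l eps Hg Heps) as (d & Hd & H).
  set (d' := if Rle_dec t 0 then d else Rmin d t).
  assert (Hd' : 0 < d').
  { unfold d'. destruct (Rle_dec t 0); [exact Hd | apply Rmin_pos; lra]. }
  exists (mkposreal d' Hd'). intros s Hs. change (Rabs (s - t) < d') in Hs.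
  change (Rabs (tangent_extension g l0 s - tangent_extension g l0 t
                - (s - t) * l) <= eps * Rabs (s - t)).
  rewrite (tangent_extension_eq g l0 t Ht).
  destruct (Rle_dec 0 s) as [Hs0|Hs0].
  - rewrite tangent_extension_eq by exact Hs0. apply H; [exact Hs0|].
    eapply Rlt_le_trans; [exact Hs|]. unfold d'.
    destruct (Rle_dec t 0); [lra | apply Rmin_l].
  - revert Hs. unfold d'. destruct (Rle_dec t 0) as [Ht0|Ht0]; intros Hs.
    + assert (E : t = 0) by lra. rewrite (Hl E), E.
      unfold tangent_extension. destruct (Rle_dec 0 s); [contradiction|].
      replace (g 0 + s * l0 - g 0 - (s - 0) * l0) with 0 by ring.
      rewrite Rabs_R0. apply Rmult_le_pos; [lra | apply Rabs_pos].
    + pose proof (Rmin_r d t). apply Rabs_def2 in Hs. lra.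
Qed.

(** * Analyticity on the strip *)

Lemma analytic_at_one_minus (g : R -> R) (x : R) :
  analytic_at g x -> analytic_at (fun t => 1 - g t) x.
Proof.
  intros (c & r & Hr & Hc). exists (PS_plus PS_one (PS_opp c)), r.
  split; [exact Hr|]. intros t Ht.
  apply (is_pseries_plus (K := R_AbsRing) (V := R_NormedModule)
           PS_one (PS_opp c) (t - x) 1 (opp (g t))).
  - apply is_pseries_PS_one.
  - exact (is_pseries_opp _ _ _ (Hc t Ht)).
Qed.

Lemma Series_two_terms (u : nat -> R) :
  (forall k, u (S (S k)) = 0) -> Series u = u 0%nat + u 1%nat.
Proof.
  intros Hu. apply is_series_unique.
  apply (is_lim_seq_incr_1 (sum_n u) (u 0%nat + u 1%nat)).
  apply is_lim_seq_ext with (fun _ => u 0%nat + u 1%nat);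
    [|apply is_lim_seq_const].
  intros n. induction n as [|n IH].
  - rewrite sum_Sn, sum_O. reflexivity.
  - rewrite sum_Sn, <- IH, Hu. unfold plus; simpl. ring.
Qed.

Lemma affine_analytic_on_strip (T : Rbar) (a A : R -> R) :
  (forall t, in_time T t -> analytic_at a t /\ analytic_at A t) ->
  analytic_on_strip T (fun t x => a t * x + A t).
Proof.
  intros Han t0 x0 Ht0. destruct (Han t0 Ht0) as [Ha HA].
  destruct (analytic_at_coef_bound a t0 Ha) as (c & r & M & Hr & Hc & Hac).
  destruct (analytic_at_coef_bound A t0 HA) as (d & s & N & Hs & Hd & HAd).
  set (rho := Rmin (Rmin r s) 1).
  assert (Hrho : 0 < rho) by (repeat apply Rmin_pos; lra).
  assert (Hle : rho <= r /\ rho <= s /\ rho <= 1).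
  { unfold rho. pose proof (Rmin_l (Rmin r s) 1).
    pose proof (Rmin_r (Rmin r s) 1).
    pose proof (Rmin_l r s). pose proof (Rmin_r r s). lra. }
  (* [a t x + A t = (a t x0 + A t) + a t (x - x0)] *)
  exists (fun i j => match j with
                     | O => c i * x0 + d i
                     | S O => c i
                     | S (S _) => 0
                     end), rho, (M * (Rabs x0 + 1) + N).
  split; [exact Hrho|]. split.
  - assert (Hci : forall i, Rabs (c i) * rho ^ i <= M).
    { intros i. eapply Rle_trans; [|exact (Hc i)].
      apply Rmult_le_compat_l; [apply Rabs_pos|]. apply pow_incr. lra. }
    assert (Hdi : forall i, Rabs (d i) * rho ^ i <= N).
    { intros i. eapply Rle_trans; [|exact (Hd i)].
      apply Rmult_le_compat_l; [apply Rabs_pos|]. apply pow_incr. lra. }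
    assert (HM : 0 <= M).
    { specialize (Hc 0%nat). simpl in Hc. pose proof (Rabs_pos (c 0%nat)). lra. }
    assert (HN : 0 <= N).
    { specialize (Hd 0%nat). simpl in Hd. pose proof (Rabs_pos (d 0%nat)). lra. }
    pose proof (Rabs_pos x0).
    assert (HMx : 0 <= M * Rabs x0) by (apply Rmult_le_pos; lra).
    intros i j.
    assert (Hpi : 0 <= rho ^ i) by (apply pow_le; lra).
    destruct j as [|[|j]].
    + rewrite Nat.add_0_r.
      apply Rle_trans with
        (Rabs (c i) * rho ^ i * Rabs x0 + Rabs (d i) * rho ^ i).
      * replace (Rabs (c i) * rho ^ i * Rabs x0 + Rabs (d i) * rho ^ i)
          with ((Rabs (c i * x0) + Rabs (d i)) * rho ^ i)
          by (rewrite Rabs_mult; ring).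
        apply Rmult_le_compat_r; [exact Hpi | apply Rabs_triang].
      * specialize (Hdi i).
        pose proof (Rmult_le_compat_r _ _ _ (Rabs_pos x0) (Hci i)). lra.
    + apply Rle_trans with M; [|lra]. rewrite Nat.add_1_r. simpl.
      specialize (Hci i). pose proof (Rabs_pos (c i)).
      assert (Rabs (c i) * rho ^ i * rho <= Rabs (c i) * rho ^ i * 1).
      { apply Rmult_le_compat_l; [apply Rmult_le_pos|]; lra. }
      lra.
    + rewrite Rabs_R0. lra.
  - intros t x Ht Htr _.
    assert (Hca : is_series (fun i => c i * (t - t0) ^ i) (a t)).
    { apply is_pseries_R. replace (a t) with (a (t0 + (t - t0)))
        by (f_equal; ring). apply Hac. lra. }
    assert (HdA : is_series (fun i => d i * (t - t0) ^ i) (A t)).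
    { apply is_pseries_R. replace (A t) with (A (t0 + (t - t0)))
        by (f_equal; ring). apply HAd. lra. }
    symmetry. apply is_series_unique.
    apply (is_series_ext (fun i => plus (scal x (c i * (t - t0) ^ i))
                                     (d i * (t - t0) ^ i))).
    { intros i. rewrite Series_two_terms by (intros; simpl; ring).
      unfold plus, scal; simpl. unfold mult; simpl. ring. }
    replace (a t * x + A t) with (plus (scal x (a t)) (A t))
      by (unfold plus, scal; simpl; unfold mult; simpl; ring).
    apply (is_series_plus (K := R_AbsRing) (V := R_NormedModule));
      [|exact HdA].
    exact (is_series_scal_l (K := R_AbsRing) (V := R_NormedModule) x _ _ Hca).
Qed.

(** * The affine Cauchy problem *)

Definition affine_system (eps : R) (i : coord) : expr :=
  match i with
  | cn => Prod (Const (- 1)) (Prod (Coord ca) (Coord cn))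
  | ca => Sum (Sum (Prod (Const (- 1)) (Prod (Coord ca) (Coord ca)))
                   (Sum (Coord cn) (Const (- 1))))
              (Prod (Const (- eps)) (Prod Density (Coord ca)))
  | cA => Sum (Sum (Prod (Const (- 1)) (Prod (Coord ca) (Coord cA)))
                   (Prod (Const (- 1)) (Coord cB)))
              (Prod (Const (- eps)) (Prod Density (Coord cA)))
  | cB => Prod (Coord cA) (Coord cn)
  end.

Definition initial_state (a0 A0 b0 B0 : R) (i : coord) : R :=
  match i with cn => 1 - b0 | ca => a0 | cA => A0 | cB => B0 end.

Lemma Derive_affine (V : R -> R) (a A x : R) :
  (forall y, V y = a * y + A) -> Derive V x = a.
Proof.
  intros HV. rewrite (Derive_ext V (fun y => a * y + A)) by exact HV.
  apply is_derive_unique. auto_derive; [exact I | ring].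
Qed.

Section CauchyProblem.

Variables (f : R -> R) (eps eta0 : R).
Hypothesis (f_analytic : forall eta, 0 < eta -> analytic_at f eta).
Hypothesis (f_nonneg : forall eta, 0 < eta -> 0 <= f eta).
Hypothesis (eps_pos : 0 < eps) (eta0_pos : 0 < eta0).

(** The continuation criterion involves the gradients alone, because the
    offsets [A] and [B] cannot become unbounded first. *)
Lemma maximal_affine_solution (a0 A0 b0 B0 : R) :
  b0 < 1 ->
  exists (T : Rbar) (V E : R -> R -> R) (n a A B : R -> R),
    cauchy_solution (fun n => eps * f n)
      (fun x => a0 * x + A0) (fun x => b0 * x + B0) T V E /\
    (forall t x, V t x = a t * x + A t) /\
    (forall t x, E t x = (1 - n t) * x + B t) /\
    gradient_solution f eps T n a /\ n 0 = 1 - b0 /\ a 0 = a0 /\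
    forall T' m M : R, T = T' -> 0 < m ->
      exists t, in_time T t /\
        ~ (m <= n t /\ Rabs (n t) <= M /\ Rabs (a t) <= M).
Proof.
  intros Hb0.
  destruct (maximal_solution f (affine_system eps) f_analytic
              (initial_state a0 A0 b0 B0)) as (T & h & y & HT & Hh & E0 & Hy & Hmax).
  { simpl. lra. }
  assert (Hsol : forall t, in_time T t ->
    (forall i, analytic_at (fun s => y s i) t) /\ 0 < y t cn /\
    is_derive (fun s => y s cn) t (- (y t ca * y t cn)) /\
    is_derive (fun s => y s ca) t
      (- (y t ca) ^ 2 + y t cn - 1 - eps * f (y t cn) * y t ca) /\
    is_derive (fun s => y s cA) t
      (- (y t ca * y t cA) - y t cB - eps * f (y t cn) * y t cA) /\
    is_derive (fun s => y s cB) t (y t cA * y t cn)).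
  { intros t [Ht0 HtT].
    assert (Hbeta : exists beta : R, t < beta /\ Rbar_le beta T).
    { destruct T as [T| |]; simpl in HtT.
      - exists T. split; [exact HtT | apply Rbar_le_refl].
      - exists (t + 1). split; [lra | exact I].
      - contradiction. }
    destruct Hbeta as (beta & Htb & HbT). pose proof (Hy beta HbT) as Hs.
    split.
    { intros i. apply (solution_analytic f (affine_system eps) f_analytic
                         (- h) beta); [exact Hs | lra]. }
    destruct (Hs t ltac:(lra)) as [Hpos Hd]. split; [exact Hpos|].
    pose proof (Hd cn) as Hdn. pose proof (Hd ca) as Hda.
    pose proof (Hd cA) as HdA. pose proof (Hd cB) as HdB.
    simpl in Hdn, Hda, HdA, HdB.
    split; [|split; [|split]].
    - evar_last; [exact Hdn | ring].
    - evar_last; [exact Hda | ring].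
    - evar_last; [exact HdA | ring].
    - exact HdB. }
  set (n := fun t => y t cn). set (a := fun t => y t ca).
  set (A := fun t => y t cA). set (B := fun t => y t cB).
  assert (Hgrad : gradient_solution f eps T n a).
  { intros t Ht. destruct (Hsol t Ht) as (_ & Hp & Hn & Ha & _).
    split; [exact Hp | split; [exact Hn | exact Ha]]. }
  exists T, (fun t x => a t * x + A t), (fun t x => (1 - n t) * x + B t), n, a, A, B.
  split; [|split; [|split; [|split; [|split; [|split]]]]].
  - constructor.
    + exact HT.
    + apply affine_analytic_on_strip. intros t Ht.
      destruct (Hsol t Ht) as (Han & _). split; apply Han.
    + apply (affine_analytic_on_strip T (fun t => 1 - n t)). intros t Ht.
      destruct (Hsol t Ht) as (Han & _).
      split; [apply analytic_at_one_minus|]; apply Han.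
    + intros t x Ht. destruct (Hsol t Ht) as (_ & Hp & Hn & Ha & HA & HB).
      fold (n t) (a t) (A t) (B t) in Hp, Hn, Ha, HA, HB.
      exists ((- (a t) ^ 2 + n t - 1 - eps * f (n t) * a t) * x
              + (- (a t * A t) - B t - eps * f (n t) * A t)), (a t),
             ((a t * n t) * x + A t * n t), (1 - n t).
      split; [|split; [|split; [|split]]].
      * apply is_derive_is_time_derive; [apply Ht|].
        apply (is_derive_plus (fun s => a s * x) A); [|exact HA].
        exact (is_derive_scal_l a t _ x Ha).
      * auto_derive; [exact I | ring].
      * apply is_derive_is_time_derive; [apply Ht|].
        apply (is_derive_plus (fun s => (1 - n s) * x) B); [|exact HB].
        apply (is_derive_scal_l (fun s => 1 - n s) t (a t * n t) x).
        evar_last.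
        { exact (is_derive_minus (fun _ => 1) n t _ _ (is_derive_const 1 t) Hn). }
        unfold minus, plus, opp, zero; simpl. ring.
      * auto_derive; [exact I | ring].
      * simpl. replace (1 - (1 - n t)) with (n t) by ring.
        split; [exact Hp|]. split; ring.
    + intros x. unfold a, A. rewrite !E0. reflexivity.
    + intros x. unfold n, B. rewrite !E0. simpl. ring.
  - reflexivity.
  - reflexivity.
  - exact Hgrad.
  - unfold n. rewrite E0. reflexivity.
  - unfold a. rewrite E0. reflexivity.
  - intros T' m M HTT' Hm. apply NNPP. intros Hno.
    assert (Hbox : forall t, in_time T t ->
              m <= n t /\ Rabs (n t) <= M /\ Rabs (a t) <= M).
    { intros t Ht. apply NNPP. intros Hout. apply Hno. exists t.
      split; assumption. }
    destruct (offset_bounded f eps f_nonneg eps_pos T n a Hgrad A B T' M)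
      as [N HN].
    + rewrite HTT'. apply Rbar_le_refl.
    + intros t Ht. destruct (Hbox t Ht) as (_ & Hn & Ha).
      split; [|exact Ha]. pose proof (Rle_abs (n t)). lra.
    + intros t Ht. destruct (Hsol t Ht) as (_ & _ & _ & _ & HA & HB).
      split; assumption.
    + destruct (Hmax T' m (Rmax M N) HTT' Hm) as (t & Ht & Hout).
      apply Hout. assert (HtT : in_time T t).
      { split; [lra|]. rewrite HTT'. simpl. lra. }
      destruct (Hbox t HtT) as (Hm' & Hn & Ha).
      destruct (HN t HtT) as [HA HB].
      pose proof (Rmax_l M N). pose proof (Rmax_r M N).
      split; [exact Hm'|]. intros []; fold (n t) (a t) (A t) (B t); lra.
Qed.

(** The coefficients are read off at [x = 0] and [x = 1], and extended to
    negative times by their tangents. *)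
Lemma affine_solution_gradients (a0 A0 b0 B0 : R) (T : Rbar) (V E : R -> R -> R) :
  cauchy_solution (fun n => eps * f n)
    (fun x => a0 * x + A0) (fun x => b0 * x + B0) T V E ->
  affine_in_space T V -> affine_in_space T E ->
  exists n a, gradient_solution f eps T n a /\
    forall t x, in_time T t ->
      Derive (fun y => V t y) x = a t /\ Derive (fun y => E t y) x = 1 - n t.
Proof.
  intros Hsol [a1 [A HV]] [b1 [B HE]].
  set (a := fun t => V t 1 - V t 0). set (n := fun t => 1 - (E t 1 - E t 0)).
  assert (HVx : forall t y, in_time T t -> V t y = a t * y + A t).
  { intros t y Ht. unfold a. rewrite !HV by exact Ht. ring. }
  assert (HEx : forall t y, in_time T t -> E t y = (1 - n t) * y + B t).
  { intros t y Ht. unfold n. rewrite !HE by exact Ht. ring. }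
  assert (HDV : forall t x, in_time T t -> Derive (fun y => V t y) x = a t).
  { intros t x Ht. apply Derive_affine with (A t). intros y. apply HVx, Ht. }
  assert (HDE : forall t x, in_time T t -> Derive (fun y => E t y) x = 1 - n t).
  { intros t x Ht. apply Derive_affine with (B t). intros y. apply HEx, Ht. }
  set (dn := fun t => - (a t * n t)).
  set (da := fun t => - (a t) ^ 2 + n t - 1 - eps * f (n t) * a t).
  assert (Hode : forall t, in_time T t ->
            0 < n t /\ is_time_derive n t (dn t) /\ is_time_derive a t (da t)).
  { intros t Ht.
    destruct (sol_system _ _ _ _ _ _ Hsol t 0 Ht)
      as (Vt0 & Vx0 & Et0 & Ex0 & HVt0 & HVx0 & HEt0 & HEx0 & Hn0 & EV0 & EE0).
    destruct (sol_system _ _ _ _ _ _ Hsol t 1 Ht)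
      as (Vt1 & Vx1 & Et1 & Ex1 & HVt1 & HVx1 & HEt1 & HEx1 & Hn1 & EV1 & EE1).
    apply is_derive_unique in HVx0, HVx1, HEx0, HEx1.
    rewrite HDV in HVx0, HVx1 by exact Ht. rewrite HDE in HEx0, HEx1 by exact Ht.
    subst Vx0 Vx1 Ex0 Ex1.
    replace (1 - (1 - n t)) with (n t) in * by ring.
    assert (Ha1 : a t = V t 1 - V t 0) by reflexivity.
    assert (Hn1' : n t = 1 - (E t 1 - E t 0)) by reflexivity.
    split; [exact Hn0|]. split.
    - apply filterdiff_ext_lin with
        (fun h => minus (scal h 0) (minus (scal h Et1) (scal h Et0))).
      + apply (filterdiff_minus_fct (fun _ => 1) (fun s => E s 1 - E s 0)
                 (fun h => scal h 0)).
        * apply is_derive_is_time_derive;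
            [apply Ht | exact (is_derive_const 1 t)].
        * exact (filterdiff_minus_fct _ _ _ _ HEt1 HEt0).
      + intros y. unfold minus, plus, opp, scal; simpl. unfold mult; simpl.
        replace (dn t) with (Et0 - Et1); [ring|]. unfold dn. nra.
    - eapply filterdiff_ext_lin.
      + exact (filterdiff_minus_fct _ _ _ _ HVt1 HVt0).
      + intros y. unfold minus, plus, opp, scal; simpl. unfold mult; simpl.
        replace (da t) with (Vt1 - Vt0); [ring|]. unfold da.
        replace Vt1 with (- E t 1 - eps * f (n t) * V t 1 - V t 1 * a t) by lra.
        replace Vt0 with (- E t 0 - eps * f (n t) * V t 0 - V t 0 * a t) by lra.
        replace (V t 1) with (a t + V t 0) by lra.
        replace (E t 1) with (1 - n t + E t 0) by lra. ring. }
  assert (Hext : forall t, in_time T t ->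
            tangent_extension n (dn 0) t = n t /\ tangent_extension a (da 0) t = a t).
  { intros t [Ht _]. split; apply tangent_extension_eq, Ht. }
  exists (tangent_extension n (dn 0)), (tangent_extension a (da 0)). split.
  - intros t Ht. destruct (Hode t Ht) as (Hp & Hn & Ha).
    destruct (Hext t Ht) as [En Ea]. rewrite En, Ea.
    split; [exact Hp|]. split.
    + apply tangent_extension_derive; [apply Ht | intros ->; reflexivity | exact Hn].
    + apply tangent_extension_derive; [apply Ht | intros ->; reflexivity | exact Ha].
  - intros t x Ht. destruct (Hext t Ht) as [En Ea]. rewrite En, Ea.
    split; [apply HDV | apply HDE]; exact Ht.
Qed.

Lemma affine_solution_bounded (a0 A0 b0 B0 : R) (T : Rbar) (V E : R -> R -> R) :
  improper_integral_diverges (fun eta => f eta / eta ^ 2) eta0 ->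
  cauchy_solution (fun n => eps * f n)
    (fun x => a0 * x + A0) (fun x => b0 * x + B0) T V E ->
  affine_in_space T V -> affine_in_space T E ->
  x_derivative_bounded T V /\ x_derivative_bounded T E.
Proof.
  intros Hdiv Hsol HV HE.
  destruct (affine_solution_gradients a0 A0 b0 B0 T V E Hsol HV HE)
    as (n & a & Hgrad & HD).
  destruct (gradient_bounded f eps eta0 f_analytic f_nonneg eps_pos eta0_pos
              T n a Hgrad Hdiv) as (m & M & Hm & HM).
  split.
  - exists M. intros t x Ht. destruct (HD t x Ht) as [-> _]. apply HM, Ht.
  - exists (1 + M). intros t x Ht. destruct (HD t x Ht) as [_ ->].
    destruct (HM t Ht) as (_ & Hn & _).
    eapply Rle_trans; [apply Rabs_triang|]. rewrite Rabs_R1, Rabs_Ropp. lra.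
Qed.

Lemma affine_of_eq (T : Rbar) (V : R -> R -> R) (a A : R -> R) :
  (forall t x, V t x = a t * x + A t) -> affine_in_space T V.
Proof. intros H. exists a, A. intros t x _. apply H. Qed.

Lemma global_affine_solution (a0 A0 b0 B0 : R) :
  improper_integral_diverges (fun eta => f eta / eta ^ 2) eta0 -> b0 < 1 ->
  exists V E,
    cauchy_solution (fun n => eps * f n)
      (fun x => a0 * x + A0) (fun x => b0 * x + B0) p_infty V E /\
    affine_in_space p_infty V /\ affine_in_space p_infty E.
Proof.
  intros Hdiv Hb0.
  destruct (maximal_affine_solution a0 A0 b0 B0 Hb0)
    as (T & V & E & n & a & A & B & Hsol & HV & HE & Hgrad & _ & _ & Hmax).
  destruct (gradient_bounded f eps eta0 f_analytic f_nonneg eps_pos eta0_pos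
              T n a Hgrad Hdiv) as (m & M & Hm & HM).
  assert (HT : T = p_infty).
  { pose proof (sol_lifespan _ _ _ _ _ _ Hsol) as HT.
    destruct T as [T| |]; [exfalso | reflexivity | contradiction].
    destruct (Hmax T m M eq_refl Hm) as (t & Ht & Hout).
    apply Hout, HM, Ht. }
  subst T. exists V, E. split; [exact Hsol|].
  split; [exact (affine_of_eq _ _ _ _ HV)
         | exact (affine_of_eq _ _ (fun t => 1 - n t) _ HE)].
Qed.

Lemma blow_up_affine_solution :
  ~ improper_integral_diverges (fun eta => f eta / eta ^ 2) eta0 ->
  exists a0 A0 b0 B0 : R, b0 < 1 /\
    exists (tstar : R) (V E : R -> R -> R),
      cauchy_solution (fun n => eps * f n)
        (fun x => a0 * x + A0) (fun x => b0 * x + B0) tstar V E /\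
      affine_in_space tstar V /\ affine_in_space tstar E /\
      x_derivative_blows_up tstar V /\ x_derivative_blows_up tstar E.
Proof.
  intros Hconv.
  destruct (damping_integral_bounded f eta0 f_analytic f_nonneg eta0_pos Hconv)
    as [K HK].
  set (a0 := - (3 + eps * (K - damping_integral f eta0 1))).
  exists a0, 0, 0, 0. split; [lra|].
  destruct (maximal_affine_solution a0 0 0 0 Rlt_0_1)
    as (T & V & E & n & a & A & B & Hsol & HV & HE & Hgrad & Hn0 & Ha0 & Hmax).
  rewrite Rminus_0_r in Hn0.
  pose proof (lifespan_le_three_quarters f eps eta0 f_analytic eps_pos eta0_pos T n a Hgrad
                K HK Hn0 Ha0) as HT1.
  pose proof (sol_lifespan _ _ _ _ _ _ Hsol) as HT0.
  destruct T as [T| |]; [|exfalso; apply HT1; exact I | contradiction].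
  simpl in HT0, HT1. apply Rnot_lt_le in HT1.
  exists T, V, E. split; [exact Hsol|].
  split; [exact (affine_of_eq _ _ _ _ HV)|].
  split; [exact (affine_of_eq _ _ (fun t => 1 - n t) _ HE)|].
  assert (Hincr : forall x t, 0 <= x <= t -> t < T ->
            n x <= n t /\ a t <= - 2 * n t).
  { intros x t Hx Ht.
    apply (density_incr_gradient_le f eps eta0 f_analytic eps_pos eta0_pos T n a Hgrad K);
      try assumption; [split; simpl; lra | lra]. }
  assert (Hunbounded : forall M, exists t, in_time T t /\ M < n t).
  { intros M. apply NNPP. intros Hno.
    destruct (gradient_bounded_of_density f eps f_nonneg eps_pos T n a Hgrad M)
      as (m & N & Hm & HN).
    { intros t Ht. apply Rnot_lt_le. intros Hlt. apply Hno.
      exists t. split; assumption. }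
    destruct (Hmax T m N eq_refl Hm) as (t & Ht & Hout).
    apply Hout, HN, Ht. }
  assert (Hlate : forall M delta, 0 < delta ->
            exists t, in_time T t /\ T - delta < t /\ M < n t /\ M < - a t).
  { intros M delta Hdelta.
    destruct (Hunbounded (Rmax M 0)) as (x & [Hx0 HxT] & HMx). simpl in HxT.
    pose proof (Rmax_l M 0). pose proof (Rmax_r M 0).
    set (t := Rmax x (T - Rmin delta T / 2)).
    pose proof (Rmin_l delta T). pose proof (Rmin_r delta T).
    assert (Hmin : 0 < Rmin delta T) by (apply Rmin_pos; lra).
    assert (Ht : x <= t < T /\ T - delta < t).
    { unfold t, Rmax. destruct (Rle_dec _ _); lra. }
    destruct (Hincr x t ltac:(lra) ltac:(lra)) as [Hn Ha].
    exists t. split; [split; simpl; lra|]. lra. }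
  split; intros M delta Hdelta.
  - destruct (Hlate M delta Hdelta) as (t & Ht & Htd & _ & HM).
    exists t, 0. split; [exact Ht|]. split; [exact Htd|].
    rewrite (Derive_affine _ (a t) (A t)) by (intros; apply HV).
    pose proof (Rle_abs (- a t)) as Habs. rewrite Rabs_Ropp in Habs. lra.
  - destruct (Hlate (M + 1) delta Hdelta) as (t & Ht & Htd & HM & _).
    exists t, 0. split; [exact Ht|]. split; [exact Htd|].
    rewrite (Derive_affine _ (1 - n t) (B t)) by (intros; apply HE).
    pose proof (Rle_abs (- (1 - n t))) as Habs. rewrite Rabs_Ropp in Habs. lra.
Qed.

End CauchyProblem.

Theorem theorem2p1 (f : R -> R) (eps eta0 : R)
  (f_analytic : forall eta : R, 0 < eta -> analytic_at f eta)
  (f_nonneg : forall eta : R, 0 < eta -> 0 <= f eta)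
  (eps_pos : 0 < eps) (eta0_pos : 0 < eta0) :
  (improper_integral_diverges (fun eta => f eta / eta ^ 2) eta0 ->
   forall a0 A0 b0 B0 : R, b0 < 1 ->
     (exists V E : R -> R -> R,
        cauchy_solution (fun n => eps * f n)
          (fun x => a0 * x + A0) (fun x => b0 * x + B0) p_infty V E /\
        affine_in_space p_infty V /\ affine_in_space p_infty E) /\
     (forall (T : Rbar) (V E : R -> R -> R),
        cauchy_solution (fun n => eps * f n)
          (fun x => a0 * x + A0) (fun x => b0 * x + B0) T V E ->
        affine_in_space T V -> affine_in_space T E ->
        x_derivative_bounded T V /\ x_derivative_bounded T E))
  /\
  (~ improper_integral_diverges (fun eta => f eta / eta ^ 2) eta0 ->
   exists a0 A0 b0 B0 : R, b0 < 1 /\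
     exists (tstar : R) (V E : R -> R -> R),
       cauchy_solution (fun n => eps * f n)
         (fun x => a0 * x + A0) (fun x => b0 * x + B0) tstar V E /\
       affine_in_space tstar V /\ affine_in_space tstar E /\
       x_derivative_blows_up tstar V /\ x_derivative_blows_up tstar E).
Proof.
  split.
  - intros Hdiv a0 A0 b0 B0 Hb0. split.
    + exact (global_affine_solution f eps eta0 f_analytic f_nonneg eps_pos
               eta0_pos a0 A0 b0 B0 Hdiv Hb0).
    + intros T V E.
      exact (affine_solution_bounded f eps eta0 f_analytic f_nonneg eps_pos
               eta0_pos a0 A0 b0 B0 T V E Hdiv).
  - exact (blow_up_affine_solution f eps eta0 f_analytic f_nonneg eps_pos
             eta0_pos).
Qed.
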